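(* Let $X$ be a locally compact Polish space and let $\sigma$ be a non-atomic Radon measure on $X$ with $\sigma(X)=\infty$. Let $\nu$ be a measure on $\mathbb R^*=\mathbb R\setminus\{0\}$ such that $\nu(\{s\in\mathbb R^*:|s|>R\})=0$ for some $R>0$. Let $\Lambda^{(n)}\in\mathscr B_0(X)$ with $\Lambda^{(1)}\subset\Lambda^{(2)}\subset\cdots$, $\bigcup_n\Lambda^{(n)}=X$, let $\Delta^{(n)}\in\mathscr B_0(\mathbb R^* )$ with $\Delta^{(1)}\subset\Delta^{(2)}\subset\cdots$, $\bigcup_n\Delta^{(n)}=\mathbb R^*$, and let $V^{(n)}:=\sigma(\Lambda^{(n)})\nu(\Delta^{(n)})>0$. For each $n$, consider the operators $A(\Lambda^{(n)}\times\Delta^{(n)};f)$, $f\in B_0(X)$, and the trace $\tau_{\Lambda^{(n)}\times\Delta^{(n)}}$ describing a sum of a random number of freely independent random measures $s_i\delta_{x_i}$, where each $(x_i,s_i)$ has distribution $\frac1{V^{(n)}}\sigma\otimes\nu$ on $\Lambda^{(n)}\times\Delta^{(n)}$ and the number of summands has Poisson distribution with parameter $\alpha=V^{(n)}$. (a) Assume that $\int_{\mathbb R^*}|s|\,d\nu(s)<\infty$. Let $A(f)$, $f\in B_0(X)$, and $\tau$ be the operators and the vacuum trace of the free Lévy white noise with Lévy measure $\nu$. Then, for any $k\in\mathbb N$ and $f_1,\dots,f_k\in B_0(X)$, $$\lim_{n\to\infty}\tau_{\Lambda^{(n)}\times\Delta^{(n)}}\big(A(\Lambda^{(n)}\times\Delta^{(n)};f_1)\cdots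 A(\Lambda^{(n)}\times\Delta^{(n)};f_k)\big)=\tau\big(A(f_1)\cdots A(f_k)\big).$$ (b) Assume, instead of $\int_{\mathbb R^*}|s|\,d\nu(s)<\infty$, only that $\int_{\mathbb R^*}s^2\,d\nu(s)<\infty$. Let $\tilde A(f)$, $f\in B_0(X)$, be the operators of the centered free Lévy white noise with Lévy measure $\nu$, and let $\tilde A(\Lambda^{(n)}\times\Delta^{(n)};f)=\sum_{N=0}^\infty\tilde A(\Lambda^{(n)}\times\Delta^{(n)},N;f)$, where $$\tilde A(\Lambda^{(n)}\times\Delta^{(n)},N;f):=A(\Lambda^{(n)}\times\Delta^{(n)},N;f)-\tau_{\Lambda^{(n)}\times\Delta^{(n)},N}\big(A(\Lambda^{(n)}\times\Delta^{(n)},N;f)\big)$$ acts in $\mathscr H(\Lambda^{(n)}\times\Delta^{(n)},N)$. Then, for any $k\in\mathbb N$ and $f_1,\dots,f_k\in B_0(X)$, $$\lim_{n\to\infty}\tau_{\Lambda^{(n)}\times\Delta^{(n)}}\big(\tilde A(\Lambda^{(n)}\times\Delta^{(n)};f_1)\cdots\tilde A(\Lambda^{(n)}\times\Delta^{(n)};f_k)\big)=\tau\big(\tilde A(f_1)\cdots\tilde A(f_k)\big).$$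
   Context: For a topological space $Y$, $\mathscr B_0(Y)$ is the collection of Borel subsets of $Y$ with compact closure; $\mathbb R^*$ carries its usual topology as a subset of $\mathbb R$, so a set in $\mathscr B_0(\mathbb R^* )$ is bounded and at positive distance from $0$. A measure on the Borel $\sigma$-algebra of $X$ is Radon if it is finite on every set of $\mathscr B_0(X)$. $B_0(X)$ is the set of all bounded measurable functions $f:X\to\mathbb R$ with compact support. For $f\in B_0(X)$, $f\otimes\mathrm{id}:X\times\mathbb R^*\to\mathbb R$ is $(f\otimes\mathrm{id})(x,s)=f(x)s$. All Hilbert spaces are real. **Free Lévy white noise.** For a real separable Hilbert space $H$, the full Fock space is $\mathscr F(H)=\bigoplus_{n=0}^\infty H^{\otimes n}$, $H^{\otimes 0}=\mathbb R$, with vacuum $\Omega=(1,0,0,\dots)$. For $h\in H$, $a^+(h)$ is the bounded operator with $a^+(h)f^{(n)}=h\otimes f^{(n)}$ for $f^{(n)}\in H^{\otimes n}$, and $a^-(h)$ is its adjoint, so that $a^-(h)\Omega=0$ and $a^-(h)f_1\otimes\dots\otimes f_n=(h,f_1)_H f_2\otimes\dots\otimes f_n$. For a bounded operator $L$ in $H$, $a^0(L)\Omega=0$ and $a^0(L)f_1\otimes\dots\otimes f_n=(Lf_1)\otimes f_2\otimes\dots\otimes f_n$. In $\mathscr F(L^2(X\times\mathbb R^*,\sigma\otimes\nu))$ define the bounded selfadjoint operators $$\tilde A(f)=a^+(f\otimes\mathrm{id})+a^0(f\otimes\mathrm{id})+a^-(f\otimes\mathrm{id}),\qquad A(f)=\tilde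 A(f)+\int_X f\,d\sigma\int_{\mathbb R^*}s\,d\nu(s)$$ (the latter when $\int|s|\,d\nu<\infty$), where in $a^0$ a function is identified with the operator of multiplication by it. $(A(f))_{f\in B_0(X)}$ is the free Lévy white noise with Lévy measure $\nu$, and $(\tilde A(f))_{f\in B_0(X)}$ the centered free Lévy white noise with Lévy measure $\nu$. The trace is $\tau(a)=(a\Omega,\Omega)$ on the algebra generated by the respective operators. **$N$ freely independent weighted atoms.** Let $\Lambda\in\mathscr B_0(X)$, $\Delta\in\mathscr B_0(\mathbb R^* )$, let $P$ be a probability measure on $E:=\Lambda\times\Delta$, and $N\in\mathbb N$. For $g\in L^2(E,P)$ put $\langle g\rangle=\int_E g\,dP$; let $H=\{g\in L^2(E,P):\langle g\rangle=0\}$ and let $H_1,\dots,H_N$ be $N$ copies of $H$. Define $$\mathscr H(E,N)=\mathbb R\oplus\bigoplus_{\substack{k\in\mathbb N,\ l_1,\dots,l_k\in\{1,\dots,N\}\\ l_j\ne l_{j+1}}}H_{l_1}\otimes\dots\otimes H_{l_k},\qquad\Psi_N=(1,0,0,\dots).$$ Let $[g]_i:=g-\langle g\rangle\in H_i$. For $f\in B_0(X)$ let $u:=(f\otimes\mathrm{id})|_E$, a bounded function. For $i\in\{1,\dots,N\}$, $M_i(E;f)$ is the bounded linear operator in $\mathscr H(E,N)$ given by $M_i(E;f)\Psi_N=\langle u\rangle\Psi_N+[u]_i$ and, for $g_j\in H_{l_j}$ with $l_j\ne l_{j+1}$: if $i\ne l_1$, $M_i(E;f)g_1\otimes\dots\otimes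 g_k=\langle u\rangle g_1\otimes\dots\otimes g_k+[u]_i\otimes g_1\otimes\dots\otimes g_k$; if $i=l_1$, $M_i(E;f)g_1\otimes\dots\otimes g_k=\langle ug_1\rangle g_2\otimes\dots\otimes g_k+[ug_1]_i\otimes g_2\otimes\dots\otimes g_k$ (for $k=1$, $g_2\otimes\dots\otimes g_k$ means $\Psi_N$ in the first term and is absent in the second). Then $$A(\Lambda\times\Delta,N;f)=\sum_{i=1}^N M_i(E;f),\qquad\tau_{\Lambda\times\Delta,N}(a)=(a\Psi_N,\Psi_N)_{\mathscr H(E,N)} .$$ For $N=0$ put $\mathscr H(E,0)=\mathbb R$, $\Psi_0=1$, $A(\Lambda\times\Delta,0;f)=0$. **Poisson number of summands.** For $\alpha>0$ let $\mathscr H(E)=\bigoplus_{N=0}^\infty\mathscr H(E,N)\frac{\alpha^N}{N!}e^{-\alpha}$, where $\mathscr Hc$ denotes $\mathscr H$ with scalar product multiplied by $c>0$. On the dense subspace of finite sequences $(F_0,F_1,\dots,F_k,0,0,\dots)$, $F_i\in\mathscr H(E,i)$, define $A(\Lambda\times\Delta;f)=\sum_{N=0}^\infty A(\Lambda\times\Delta,N;f)$, where $A(\Lambda\times\Delta,N;f)$ acts in the component $\mathscr H(E,N)$. On the algebra generated by these operators (or by the operators $\tilde A(\Lambda\times\Delta;f)$ of the claim), $$\tau_{\Lambda\times\Delta}(a)=\sum_{N=0}^\infty(a\Psi_N,\Psi_N)_{\mathscr H(E,N)}\frac{\alpha^N}{N!}e^{-\alpha}$$ (the series converges). In the claim this is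 used with $\Lambda=\Lambda^{(n)}$, $\Delta=\Delta^{(n)}$, $P=\frac1{V^{(n)}}\sigma\otimes\nu$, $\alpha=V^{(n)}$. *)

(* Defs.v *)
From HB Require Import structures.
From mathcomp Require Import all_boot all_order all_algebra.
From mathcomp Require Import all_classical all_reals all_analysis.
Set Implicit Arguments.
Unset Strict Implicit.
Unset Printing Implicit Defensive.
Import Order.TTheory GRing.Theory Num.Theory.
Import numFieldNormedType.Exports.
Local Open Scope classical_set_scope.
Local Open Scope ring_scope.

Definition separable (T : topologicalType) :=
  exists2 D : set T, countable D & dense D.

Definition completely_metrizable (R : realType) (T : topologicalType) :=
  exists d : T -> T -> R,
    [/\ forall x y, d x y = 0 <-> x = y,
        forall x y, d x y = d y x,
        forall x y z, d x z <= d x y + d y z,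
        forall x (U : set T),
          nbhs x U <-> exists2 e, 0 < e & [set y | d x y < e] `<=` U &
        forall u : nat -> T,
          (forall e, 0 < e -> exists N, forall m n,
             (N <= m)%N -> (N <= n)%N -> d (u m) (u n) < e) ->
          exists l : T, u @ \oo --> l].

Definition polish (R : realType) (T : topologicalType) :=
  separable T /\ completely_metrizable R T.

Definition borel (T : ptopologicalType) := g_sigma_algebraType (@open T).

(* $\mathbb R^*$ with the topology induced by $\mathbb R$. *)
Definition Rstar (R : realType) : Type := [set s : R | s != 0].
HB.instance Definition _ (R : realType) :=
  Topological.copy (Rstar R) (set_type [set s : R | s != 0]).
HB.instance Definition _ (R : realType) :=
  isPointed.Build (Rstar R)
    (exist _ 1 (mem_set (oner_neq0 R : [set s : R | s != 0] 1))).

Definition Rstar_val (R : realType) : Rstar R -> R := set_val.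

(* $\mathscr B_0(T)$; the closure is taken in [T]. *)
Definition B0 (T : ptopologicalType) : set (set T) :=
  [set A | measurable (A : set (borel T)) /\ compact (closure A)].

Definition radon (R : realType) (T : ptopologicalType)
    (mu : set (borel T) -> \bar R) :=
  forall A : set T, B0 A -> (mu A < +oo)%E.

Definition nonatomic d (T : measurableType d) (R : realType)
    (mu : set T -> \bar R) :=
  forall A, measurable A -> (0 < mu A)%E ->
    exists B, [/\ measurable B, B `<=` A, (0 < mu B)%E & (mu B < mu A)%E].

(* $B_0(X)$ *)
Definition B0fun (R : realType) (T : ptopologicalType) : set (T -> R) :=
  [set f | [/\ measurable_fun [set: borel T] (f : borel T -> R),
               bounded_fun f &
               compact (closure [set x | f x != 0])]].

Definition otimes_id (R : realType) (X : ptopologicalType) (f : X -> R)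
  : (borel X * borel (Rstar R))%type -> R := fun z => f z.1 * Rstar_val z.2.

(* $(f\otimes\mathrm{id})|_{\Lambda\times\Delta}$, extended by 0 *)
Definition otimes_id_on (R : realType) (X : ptopologicalType)
    (L : set X) (D : set (Rstar R)) (f : X -> R)
  : (borel X * borel (Rstar R))%type -> R := otimes_id f \_ (L `*` D).

HB.mixin Record CompleteNormedModule_isHilbert (R : realType) H
    of CompleteNormedModule R H := {
  inner : H -> H -> R ;
  innerC : forall x y, inner x y = inner y x ;
  inner_linearl : forall (a : R) x y z,
    inner (a *: x + y) z = a * inner x z + inner y z ;
  inner_norm : forall x, inner x x = `|x| ^+ 2 }.

#[short(type="hilbertType")]
HB.structure Definition Hilbert (R : realType) :=
  {H of CompleteNormedModule R H & CompleteNormedModule_isHilbert R H}.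

Definition bounded_operator (R : realType) (H : hilbertType R) (T : H -> H) :=
  linear T /\ exists C : R, forall x, `|T x| <= C * `|x|.

Definition adjoint (R : realType) (H : hilbertType R) (T S : H -> H) :=
  forall x y, inner (T x) y = inner x (S y).

Definition lin_span (R : realType) (H : hilbertType R) (A : set H) : set H :=
  [set x | exists n (c : 'I_n -> R) (v : 'I_n -> H),
     (forall i, A (v i)) /\ x = \sum_(i < n) c i *: v i].

Definition op_prod (T : Type) (k : nat) (a : 'I_k -> T -> T) : T -> T :=
  \big[(fun b c => b \o c)/idfun]_(i < k) a i.

Section fock.
Context {R : realType} {d : measure_display} {Y : measurableType d}.
Implicit Types (mu : {measure set Y -> \bar R}) (u h : Y -> R).

Definition square_integrable mu (s : seq (Y -> R)) :=
  forall h, h \in s -> h \in Lfun mu 2%:E.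

(* The full Fock space $\bigoplus_n L^2(Y,\mu)^{\otimes n}$: the Hilbert space,
   unique up to a unique unitary, in which the $f_1\otimes\dots\otimes f_n$
   ([fock_tensor [:: f_1; ...; f_n]]) are total and have the inner products
   $\delta_{mn}\prod_i (f_i,g_i)$.  The vacuum is the empty tensor. *)
Record fockSpace mu := FockSpace {
  fock_sort :> hilbertType R ;
  fock_tensor : seq (Y -> R) -> fock_sort ;
  fock_inner : forall s t, square_integrable mu s -> square_integrable mu t ->
    inner (fock_tensor s) (fock_tensor t) =
      if size s == size t
      then \prod_(p <- zip s t) \int[mu]_y (p.1 y * p.2 y) else 0 ;
  fock_total : dense (lin_span (fock_tensor @` [set s | square_integrable mu s]))
}.

Context (mu : {measure set Y -> \bar R}) (F : fockSpace mu).
Implicit Type a : F -> F.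

Definition vacuum : F := fock_tensor F [::].

(* $a^+(h)$, for $h\in L^2$ *)
Definition is_creation h a :=
  bounded_operator a /\
  forall s, square_integrable mu s ->
    a (fock_tensor F s) = fock_tensor F (h :: s).

(* $a^-(h)$ *)
Definition is_annihilation h a :=
  bounded_operator a /\ exists2 b, is_creation h b & adjoint b a.

(* $a^0(L)$, for $L$ the multiplication by a $\mu$-essentially bounded $u$ *)
Definition is_preservation u a :=
  [/\ bounded_operator a, a vacuum = 0 &
      forall f s, square_integrable mu (f :: s) ->
        a (fock_tensor F (f :: s)) = fock_tensor F ((u \* f) :: s)].

Definition fock_trace a : R := inner (a vacuum) vacuum.

End fock.

Section levy_noise.
Context {R : realType} {X : ptopologicalType}.
Context (sigma : {measure set (borel X) -> \bar R}).
Context (nu : {sigma_finite_measure set (borel (Rstar R)) -> \bar R}).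
Context (F : fockSpace (sigma \x nu)%E).

Definition is_centered_levy_noise (At : (X -> R) -> F -> F) :=
  forall f : X -> R, B0fun f -> exists ap a0 am : F -> F,
    [/\ is_creation (otimes_id f) ap, is_preservation (otimes_id f) a0,
        is_annihilation (otimes_id f) am &
        At f = fun x => ap x + a0 x + am x].

Definition is_levy_noise (A : (X -> R) -> F -> F) :=
  exists2 At, is_centered_levy_noise At &
    forall f : X -> R, B0fun f -> A f = fun x => At f x +
      ((\int[sigma]_x (f x : R)) * \int[nu]_s Rstar_val s) *: x.

End levy_noise.

Section free_atoms.
Context {R : realType} {d : measure_display} {Y : measurableType d}.
Context (P : probability Y R) (N : nat).
Implicit Types (g u : Y -> R) (i : 'I_N) (w : seq ('I_N * (Y -> R))).

Definition mean g : R := \int[P]_y g y.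

Definition center g : Y -> R := fun y => g y - mean g.

(* [:: (l_1, g_1); ...; (l_k, g_k)] with $g_j\in L^2(P)$, $\langle g_j\rangle=0$
   and $l_j\ne l_{j+1}$ *)
Definition admissible w :=
  (forall p, p \in w -> p.2 \in Lfun P 2%:E /\ mean p.2 = 0) /\
  sorted (fun l l' => l != l') (unzip1 w).

(* $\mathscr H(E,N)$, up to a unique unitary; [atom_tensor w] is
   $g_1\otimes\dots\otimes g_k\in H_{l_1}\otimes\dots\otimes H_{l_k}$, and
   [atom_tensor [::]] is $\Psi_N$.  For $N=0$ the space is the line of
   $\Psi_0$. *)
Record atomSpace := AtomSpace {
  atom_sort :> hilbertType R ;
  atom_tensor : seq ('I_N * (Y -> R)) -> atom_sort ;
  atom_inner : forall w w', admissible w -> admissible w' ->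
    inner (atom_tensor w) (atom_tensor w') =
      if unzip1 w == unzip1 w'
      then \prod_(p <- zip (unzip2 w) (unzip2 w')) mean (p.1 \* p.2) else 0 ;
  atom_total : dense (lin_span (atom_tensor @` [set w | admissible w]))
}.

Context (K : atomSpace).

Definition atom_vacuum : K := atom_tensor K [::].

(* $M_i(E;f)$, as a function of $u=(f\otimes\mathrm{id})|_E$ *)
Definition is_atom_operator i u (M : K -> K) :=
  [/\ bounded_operator M,
      M atom_vacuum = mean u *: atom_vacuum + atom_tensor K [:: (i, center u)] &
      forall l1 g1 w, admissible ((l1, g1) :: w) ->
        M (atom_tensor K ((l1, g1) :: w)) =
          if i == l1
          then mean (u \* g1) *: atom_tensor K w
               + atom_tensor K ((i, center (u \* g1)) :: w)
          else mean u *: atom_tensor K ((l1, g1) :: w)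
               + atom_tensor K [:: (i, center u), (l1, g1) & w]].

Definition is_atom_sum u (A : K -> K) :=
  exists2 M : 'I_N -> K -> K, forall i, is_atom_operator i u (M i) &
    A = fun x => \sum_(i < N) M i x.

Definition atom_trace (a : K -> K) : R := inner (a atom_vacuum) atom_vacuum.

Definition centered_op (a : K -> K) : K -> K := fun x => a x - atom_trace a *: x.

End free_atoms.

Section poisson_sum.
Context {R : realType} {d : measure_display} {Y : measurableType d}.
Context (P : probability Y R) (alpha : R) (K : forall N, atomSpace P N).

(* Sequences $(F_0,F_1,\dots)$ with $F_N\in\mathscr H(E,N)$; all operators
   considered act componentwise, hence preserve the finite sequences. *)
Definition atom_seq := forall N, K N.

Definition poisson_op (a : forall N, K N -> K N) : atom_seq -> atom_seq :=
  fun x N => a N (x N).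

(* $\Psi_N$ as a sequence concentrated in the component $N$ *)
Definition atom_vacuum_at N : atom_seq := dfwith (fun=> 0) N (atom_vacuum (K N)).

Definition poisson_trace (a : atom_seq -> atom_seq) : R :=
  limn (series (fun N =>
    inner (a (atom_vacuum_at N) N) (atom_vacuum (K N)) *
    (alpha ^+ N / N`!%:R * expR (- alpha)))).

End poisson_sum.

(* Main.v *)
Require Import Defs.
From HB Require Import structures.
From mathcomp Require Import all_boot all_order all_algebra.
From mathcomp Require Import all_classical all_reals all_analysis.
From mathcomp Require Import measurable_realfun zify.
Set Implicit Arguments.
Unset Strict Implicit.
Unset Printing Implicit Defensive.
Import Order.TTheory GRing.Theory Num.Theory.
Import numFieldNormedType.Exports.
Local Open Scope classical_set_scope.
Local Open Scope ring_scope.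

(** Everything rests on one recursion.  For centered functions [g_1, ..., g_m]
    let [T(g_1, ..., g_m)] be the sum, over all words [l_1 ... l_m] in the [N]
    copies with different neighbours, of [g_1 (x) ... (x) g_m] placed in
    [H_(l_1) (x) ... (x) H_(l_m)] (this is [spread]).  If [A(u)] is the sum of
    the [N] free copies of the multiplication by [u], and [<u>] its mean, then
    counting which copies may act on the first factor gives ([atom_sum_cons])
    - [A(u) T(g, gs) = T(u', g, gs) + T((u g)', gs) + (N - 1) <u> T(g, gs)
      + <u g> (N - 1) T(gs)],
    where the prime is centering and the last [N - 1] is [N] if [gs] is empty;
    moreover [A(u) Psi = N <u> Psi + T(u')].  Creation, preservation and
    annihilation on the full Fock space act on [g (x) gs] in the same way:
    prepend [u], multiply [g] by [u], integrate [u g].  Put [t = N / alpha],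
    [e = 1 / alpha] and [J(g) = alpha <g>], which is the integral of [g] over
    the box.  Then a moment of [N] atoms is the value at [t] of a polynomial
    [moment], whose coefficients are computed recursively from [e] and [J]
    ([atom_moment]); and a Fock moment is the value at [1] of the polynomial
    obtained for [e = 0] and [J] the integral over the whole space
    ([fock_moment]).  A drift parameter covers the centered and the uncentered
    noise together.

    So it remains to show two things.  The moments of [N / alpha] tend to [1]
    as the Poisson parameter [alpha] tends to infinity ([poisson_moment]), and
    degrees are bounded by the number of factors; hence Poisson averages of
    polynomials with convergent coefficients tend to the value at [1] of the
    limit ([poisson_poly_cvg]).  And the coefficients converge ([moment_cvg]):
    the integrals [J(u g)] converge by dominated convergence, since a product
    of two or more of the functions [f(x) s] is dominated by a multiple of
    [Phi ^ 2], where [Phi(x, s) = |s|] for [x] in a set [L] of finite measure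
    containing the supports, and [Phi = 0] elsewhere.

    Only the centering constants need care, because [Phi] need not be
    integrable when merely [s ^ 2] is.  By Young's inequality the integral of
    [Phi] over the box [Lambda_n * Delta_n] is at most
    [q_n = C sqrt(nu(Delta_n))], so that these constants are of order [e q_n],
    and the error they cause in [J(u g)] is of order
    [e q_n ^ 2 = C ^ 2 / sigma(Lambda_n)], which tends to zero as
    [sigma(X) = oo]. *)

(** * Vectors orthogonal to a total family *)

Section hilbert.
Context {R : realType} {H : hilbertType R}.
Implicit Types (x y z : H) (A : set H).

Lemma innerDl x y z : inner (x + y) z = inner x z + inner y z.
Proof. by rewrite -{1}(scale1r x) inner_linearl mul1r. Qed.

Lemma inner0l z : inner 0 z = 0.
Proof. by apply: (addIr (inner 0 z)); rewrite -innerDl !add0r. Qed.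

Lemma innerZl a x z : inner (a *: x) z = a * inner x z.
Proof. by rewrite -[a *: x]addr0 inner_linearl inner0l addr0. Qed.

Lemma innerBr x y z : inner z (x - y) = inner z x - inner z y.
Proof. by rewrite !(innerC z) innerDl -scaleN1r innerZl mulN1r. Qed.

Lemma inner_suml (J : Type) (r : seq J) (Q : pred J) (F : J -> H) z :
  inner (\sum_(j <- r | Q j) F j) z = \sum_(j <- r | Q j) inner (F j) z.
Proof.
apply: (big_morph (fun x => inner x z)); last exact: inner0l.
by move=> x y; rewrite innerDl.
Qed.

(** By Pythagoras every vector of the span is at distance at least
    [`|v|] from a vector [v] orthogonal to it. *)
Lemma total_orthogonal_eq0 A v : dense (lin_span A) ->
  (forall a, A a -> inner a v = 0) -> v = 0.
Proof.
move=> dA ortho; apply/eqP; apply: contraT => v0.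
have vgt0 : 0 < `|v| by rewrite normr_gt0.
have [] := dA (ball v `|v|) _ (ball_open v `|v|).
  by exists v; exact: ballxx.
move=> a [/= va [n [c [w [Aw aE]]]]].
have av : inner a v = 0.
  by rewrite aE inner_suml big1// => i _; rewrite innerZl ortho ?mulr0.
move: va; rewrite -ball_normE /=.
rewrite -(ltr_pXn2r (n := 2)) ?nnegrE//.
rewrite -!inner_norm innerBr ![inner (v - a) _]innerC !innerBr.
by rewrite av (innerC v a) av subr0 sub0r opprK ltNge lerDl inner_norm sqr_ge0.
Qed.

End hilbert.

(** * Products of operators and the moment recursion *)

Section run.
Context {R : realType} {H : lmodType R} {I : Type} (A : I -> H -> H).

(** The operators are applied to [x] from the first one of [us] on, so a
    product [A u_1 \o ... \o A u_k] is [run] along [:: u_k; ...; u_1]. *)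
Definition run (us : seq I) (x : H) : H := foldl (fun y u => A u y) x us.

Hypothesis lA : forall u, linear (A u).

Lemma run_linear us : linear (run us).
Proof.
elim: us => //= u us IH a x y; rewrite /run /= lA; exact: IH.
Qed.

Lemma runD us x y : run us (x + y) = run us x + run us y.
Proof. by rewrite -{1}(scale1r x) run_linear scale1r. Qed.

Lemma run0 us : run us 0 = 0.
Proof. by apply: (addIr (run us 0)); rewrite -runD !add0r. Qed.

Lemma runZ us a x : run us (a *: x) = a *: run us x.
Proof. by rewrite -[a *: x]addr0 run_linear run0 addr0. Qed.

End run.

Lemma op_prod_run {R : realType} {H : lmodType R} k (A : 'I_k -> H -> H) x :
  op_prod A x = run A (rev (index_enum 'I_k)) x.
Proof.
rewrite /op_prod /run foldl_rev.
by elim: (index_enum _) => [|i s IH]; rewrite ?big_nil// big_cons /= IH.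
Qed.

Section moment.
Context {R : realType} {Y I : Type} (U : I -> Y -> R).

(** With [e = 1 / alpha] and [J g = alpha * mean g] this is centering; with
    [e = 0] it is the identity. *)
Definition recenter (e : R) (J : (Y -> R) -> R) (g : Y -> R) : Y -> R :=
  fun y => g y - e * J g.

(** The vacuum expectation of the operators with symbols [U u], for [u] along
    [us] (first one acting first), on the tensor [gs], as a polynomial in the
    number of atoms divided by its mean.  The terms are, in this order,
    creation, preservation, the scalar part, and annihilation; [c] is the
    drift. *)
Fixpoint moment (e : R) (J : (Y -> R) -> R) (c : I -> R) (us : seq I)
    (gs : seq (Y -> R)) : {poly R} :=
  if us is u :: us' then
    if gs is g :: gs' then
      moment e J c us' [:: recenter e J (U u), g & gs']
      + moment e J c us' (recenter e J (U u \* g) :: gs')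
      + (c u *: 'X - (e * J (U u))%:P) * moment e J c us' (g :: gs')
      + J (U u \* g) *: ('X - (e * (gs' != [::])%:R)%:P) * moment e J c us' gs'
    else moment e J c us' [:: recenter e J (U u)]
         + c u *: 'X * moment e J c us' [::]
  else (gs == [::])%:R.

End moment.

(** * Moments on the full Fock space *)

Section fock_space.
Context {R : realType} {d : measure_display} {Y : measurableType d}.
Context {mu : {measure set Y -> \bar R}} {F : fockSpace mu}.
Implicit Types (g h : Y -> R) (s t : seq (Y -> R)).

Lemma square_integrable_cons g s : g \in Lfun mu 2%:E ->
  square_integrable mu s -> square_integrable mu (g :: s).
Proof. by move=> Lg Ls h; rewrite inE => /predU1P[->|/Ls]. Qed.

(** The annihilation operator is only given as an adjoint, so its action on
    tensors is read off from inner products with the total family of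
    tensors. *)
Lemma annihilation_inner h (am : F -> F) x (v : F) : is_annihilation h am ->
  h \in Lfun mu 2%:E ->
  (forall t, square_integrable mu t ->
     inner (fock_tensor F (h :: t)) x = inner (fock_tensor F t) v) ->
  am x = v.
Proof.
move=> [_ [b [_ bE] adj]] Lh xv; apply/eqP; rewrite -subr_eq0; apply/eqP.
apply: (total_orthogonal_eq0 (@fock_total _ _ _ _ F)) => _ [t Lt <-].
by rewrite innerBr -adj bE// xv// subrr.
Qed.

Lemma annihilation_cons h (am : F -> F) g s : is_annihilation h am ->
  h \in Lfun mu 2%:E -> square_integrable mu (g :: s) ->
  am (fock_tensor F (g :: s)) = \int[mu]_y (h y * g y) *: fock_tensor F s.
Proof.
move=> ham Lh Lgs; apply: (annihilation_inner ham Lh) => t Lt.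
have Ls : square_integrable mu s by move=> k ks; apply: Lgs; rewrite inE ks orbT.
rewrite fock_inner//; last exact: square_integrable_cons.
rewrite innerC innerZl innerC fock_inner//= eqSS.
by case: ifP => _; rewrite ?mulr0// big_cons.
Qed.

Lemma annihilation_vacuum h (am : F -> F) : is_annihilation h am ->
  h \in Lfun mu 2%:E -> am (vacuum F) = 0.
Proof.
move=> ham Lh; apply: (annihilation_inner ham Lh) => t Lt.
rewrite fock_inner//; last exact: square_integrable_cons.
by rewrite innerC inner0l.
Qed.

Section moments.
Context {I : Type} (U : I -> Y -> R) (c : I -> R) (A : I -> F -> F).
Context (Q : set (Y -> R)).
Hypothesis QL : forall g, Q g -> g \in Lfun mu 2%:E.
Hypothesis QU : forall u, Q (U u).
Hypothesis QM : forall u g, Q g -> Q (U u \* g).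
Hypothesis AE : forall u, exists ap a0 am : F -> F,
  [/\ is_creation (U u) ap, is_preservation (U u) a0,
      is_annihilation (U u) am &
      A u = fun x => ap x + a0 x + am x + c u *: x].

Let A_linear u : linear (A u).
Proof.
have [ap [a0 [am [[[lp _] _] [[l0 _] _ _] [[lm _] _] ->]]]] := AE u.
move=> a x y; rewrite lp l0 lm (scalerDr (c u)) scalerA mulrC -scalerA.
rewrite (addrACA (a *: ap x)) (addrACA (_ + a *: a0 x)).
by rewrite (addrACA (_ + a *: am x)) -!scalerDr.
Qed.

(** With [e = 0] recentering is the identity and the terms of [moment] are
    those of the operator acting on a tensor. *)
Lemma fock_moment us gs : (forall g, g \in gs -> Q g) ->
  inner (run A us (fock_tensor F gs)) (vacuum F) =
  (moment U 0 (fun g => \int[mu]_y g y) c us gs).[1].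
Proof.
have r0 (g : Y -> R) : recenter 0 (fun g => \int[mu]_y g y) g = g.
  by apply/funext => y; rewrite /recenter mul0r subr0.
elim: us gs => [|u us IH] gs Qgs.
  rewrite /= fock_inner; last 2 first.
  - by move=> g /Qgs/QL.
  - by [].
  case: gs Qgs => [_|g gs _]; first by rewrite big_nil hornerC.
  by rewrite /= hornerC.
have Lgs : square_integrable mu gs by move=> g /Qgs/QL.
have QLU := QL (QU u).
have [ap [a0 [am [[_ hp] [_ h0v h0] hm AuE]]]] := AE u.
case: gs Qgs Lgs => [_ _|g gs Qgs Lgs].
  rewrite /run /= AuE /= -/(vacuum F) h0v (annihilation_vacuum hm)// hp//.
  rewrite !addr0 -/(run A us _) runD// runZ// innerDl innerZl !IH//; last first.
    by move=> g; rewrite inE => /eqP ->.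
  by rewrite r0 !hornerE.
have Qg : Q g by apply: Qgs; rewrite mem_head.
have Qgs' h : h \in gs -> Q h by move=> hgs; apply: Qgs; rewrite inE hgs orbT.
rewrite /run /= AuE /= hp// h0// (annihilation_cons hm)// -/(run A us _).
rewrite !runD// !runZ// !innerDl !innerZl !IH//; last 2 first.
- by move=> h; rewrite inE => /predU1P[->|/Qgs'//]; exact: QM.
- by move=> h; rewrite inE => /predU1P[->//|/Qgs].
by rewrite !r0 !hornerE !subr0 mulr1 [LHS]addrAC.
Qed.

End moments.
End fock_space.

(** * Moments of a sum of free atoms *)

Section words.
Context {N : nat}.
Implicit Types (i l : 'I_N) (w : seq 'I_N).

Definition fresh i w : bool := if w is l :: _ then i != l else true.

Fixpoint alternating (k : nat) : seq (seq 'I_N) :=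
  if k is k'.+1 then
    [seq i :: w | w <- alternating k', i <- [seq i <- index_enum 'I_N | fresh i w]]
  else [:: [::]].

Lemma alternatingP k w : w \in alternating k ->
  size w = k /\ sorted (fun l l' => l != l') w.
Proof.
elim: k w => [|k IH] w /=; first by rewrite inE => /eqP ->.
move=> /allpairsPdep[v [i [/IH[<- sv]]]]; rewrite mem_filter => /andP[iv _] ->.
by case: v iv sv => //= l v -> ->.
Qed.

Lemma sum_alternating {V : nmodType} k (G : seq 'I_N -> V) :
  \sum_(w <- alternating k.+1) G w =
  \sum_(w <- alternating k) \sum_(i | fresh i w) G (i :: w).
Proof.
rewrite big_allpairs_dep; apply: eq_bigr => w _ /=.
by rewrite big_filter.
Qed.

Lemma sum_fresh {R : pzRingType} w :
  \sum_(i | fresh i w) (1 : R) = N%:R - (w != [::])%:R.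
Proof.
rewrite sumr_const; case: w => [|l w] /=; first by rewrite card_ord subr0.
have -> : #|fresh^~ (l :: w)| = #|predC1 l| by apply: eq_card => i.
by rewrite cardC1 card_ord; case: N l => [[]//|n _] /=; rewrite -natr1 addrK.
Qed.

End words.

Section atom_space.
Context {R : realType} {d : measure_display} {Y : measurableType d}.
Context {P : probability Y R} {N : nat} {K : atomSpace P N}.
Implicit Types (g : Y -> R) (gs : seq (Y -> R)).

(** Summing over all admissible choices of copies makes the vector symmetric
    under permutations of the copies, as is the sum of all atoms: that is why
    the span of these vectors is invariant. *)
Definition spread gs : K :=
  \sum_(w <- alternating (size gs)) atom_tensor K (zip w gs).

Lemma spread_nil : spread [::] = atom_vacuum K.
Proof. by rewrite /spread /= big_seq1. Qed.

Lemma spread_cons g gs : spread (g :: gs) =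
  \sum_(w <- alternating (size gs)) \sum_(i | fresh i w)
     atom_tensor K ((i, g) :: zip w gs).
Proof. exact: sum_alternating. Qed.

Definition centered_L2 g := g \in Lfun P 2%:E /\ mean P g = 0.

Lemma admissible_zip w gs : size w = size gs ->
  sorted (fun l l' : 'I_N => l != l') w ->
  (forall g, g \in gs -> centered_L2 g) -> admissible P (zip w gs).
Proof.
move=> sw aw Lgs; split; last by rewrite unzip1_zip ?sw.
move=> [i g] /(map_f snd) /=; rewrite -/(unzip2 _) unzip2_zip ?sw//.
exact: Lgs.
Qed.

Lemma admissible_nil : @admissible R d Y P N [::].
Proof. by split. Qed.

Lemma inner_spread_vacuum gs : (forall g, g \in gs -> centered_L2 g) ->
  inner (spread gs) (atom_vacuum K) = (gs == [::])%:R.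
Proof.
case: gs => [_|g gs Lgs].
  rewrite spread_nil atom_inner; [|exact: admissible_nil..].
  by rewrite !eqxx /= big_nil.
rewrite /spread inner_suml big_seq big1 // => w /alternatingP[sw aw].
rewrite atom_inner; [|exact: admissible_zip|exact: admissible_nil].
by case: w sw {aw}.
Qed.

Lemma center_recenter (V : R) g : V != 0 ->
  Defs.center P g = recenter V^-1 (fun h => V * mean P h) g.
Proof. by move=> V0; apply/funext => y; rewrite /recenter mulKf. Qed.

Section moments.
Context {I : Type} (U : I -> Y -> R) (Q : set (Y -> R)).
Hypothesis QL : forall g, Q g -> centered_L2 g.
Hypothesis QU : forall u, Q (Defs.center P (U u)).
Hypothesis QM : forall u g, Q g -> Q (Defs.center P (U u \* g)).
Context (M : I -> 'I_N -> K -> K).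
Hypothesis ME : forall u i, is_atom_operator i (U u) (M u i).

Let atom_operator_vacuum i u (m : K -> K) : is_atom_operator i u m ->
  m (atom_vacuum K) =
  mean P u *: atom_vacuum K + atom_tensor K [:: (i, Defs.center P u)].
Proof. by case. Qed.

Let M_linear u i : linear (M u i). Proof. by have [[]] := ME u i. Qed.

Let S u (x : K) : K := \sum_i M u i x.

Let S_linear u : linear (S u).
Proof.
move=> a x y; rewrite /S scaler_sumr -big_split /=.
by apply: eq_bigr => i _; rewrite M_linear.
Qed.

Let S_sum u (J : Type) (r : seq J) (p : pred J) (G : J -> K) :
  S u (\sum_(j <- r | p j) G j) = \sum_(j <- r | p j) S u (G j).
Proof.
have SD x y : S u (x + y) = S u x + S u y.
  by rewrite -{1}(scale1r x) S_linear scale1r.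
apply: (big_morph (S u)) => //.
by apply: (addIr (S u 0)); rewrite -SD !add0r.
Qed.

Lemma atom_sum_vacuum u :
  S u (atom_vacuum K) =
  (N%:R * mean P (U u)) *: atom_vacuum K + spread [:: Defs.center P (U u)].
Proof.
rewrite spread_cons /= big_seq1 /S.
under [LHS]eq_bigr => i _ do rewrite (atom_operator_vacuum (ME u i)).
rewrite big_split /= sumr_const card_ord -scaler_nat scalerA.
by congr +%R; apply: eq_bigr => i _.
Qed.

(** Among the [N] atoms, the one in the copy of the first factor [g] either
    absorbs it or multiplies it; each of the [N - 1] others puts a factor in
    front of it or acts as the scalar [mean P (U u)].  Absorbing [g] leaves
    [spread gs], each term of which arises from as many copies as are
    available for [g]: all [N] if [gs] is empty, and [N - 1] if not. *)
Lemma atom_sum_cons u g gs : (forall h, h \in g :: gs -> Q h) ->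
  S u (spread (g :: gs)) =
  spread [:: Defs.center P (U u), g & gs] + spread (Defs.center P (U u \* g) :: gs)
  + ((N%:R - 1) * mean P (U u)) *: spread (g :: gs)
  + (mean P (U u \* g) * (N%:R - (gs != [::])%:R)) *: spread gs.
Proof.
move=> Qgs; rewrite {1}spread_cons S_sum.
transitivity (\sum_(w <- alternating (size gs)) \sum_(i | fresh i w)
  (mean P (U u \* g) *: atom_tensor K (zip w gs)
   + atom_tensor K ((i, Defs.center P (U u \* g)) :: zip w gs)
   + (((N%:R - 1) * mean P (U u)) *: atom_tensor K ((i, g) :: zip w gs)
      + \sum_(j | j != i)
          atom_tensor K [:: (j, Defs.center P (U u)), (i, g) & zip w gs]))).
  rewrite !big_seq; apply: eq_bigr => w /alternatingP[sw aw].
  rewrite S_sum; apply: eq_bigr => i iw.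
  have adm : admissible P ((i, g) :: zip w gs).
    apply: (@admissible_zip (i :: w) (g :: gs)) => /=; first by rewrite sw.
    - by case: w iw aw {sw} => //= l w -> ->.
    - by move=> h /Qgs/QL.
  rewrite /S (bigD1 i)//=; congr +%R.
    by have [_ _ ->//] := ME u i; rewrite eqxx.
  have -> : (N%:R - 1) * mean P (U u) = \sum_(j | j != i) mean P (U u).
    rewrite sumr_const -[RHS]mulr_natl; congr (_ * _).
    by rewrite -(@sum_fresh _ _ [:: i]) sumr_const.
  rewrite scaler_suml -big_split /=; apply: eq_bigr => j ji.
  by have [_ _ ->//] := ME u j; rewrite (negbTE ji).
under eq_bigr => w _ do rewrite !big_split /=.
rewrite !big_split /= -spread_cons.
have -> : \sum_(w <- alternating (size gs)) \sum_(i | fresh i w)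
    ((N%:R - 1) * mean P (U u)) *: atom_tensor K ((i, g) :: zip w gs) =
    ((N%:R - 1) * mean P (U u)) *: spread (g :: gs).
  rewrite spread_cons scaler_sumr; apply: eq_bigr => w _.
  by rewrite scaler_sumr.
have -> : \sum_(w <- alternating (size gs)) \sum_(i | fresh i w)
    mean P (U u \* g) *: atom_tensor K (zip w gs) =
    (mean P (U u \* g) * (N%:R - (gs != [::])%:R)) *: spread gs.
  rewrite scaler_sumr !big_seq; apply: eq_bigr => w /alternatingP[sw _].
  rewrite -scaler_suml; congr (_ *: _).
  rewrite -[X in \sum_(i | _) X]mulr1 -mulr_sumr sum_fresh.
  by rewrite -!size_eq0 sw.
have -> : \sum_(w <- alternating (size gs)) \sum_(i | fresh i w)
    \sum_(j | j != i)
      atom_tensor K [:: (j, Defs.center P (U u)), (i, g) & zip w gs] =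
    spread [:: Defs.center P (U u), g & gs].
  by rewrite spread_cons /= -/(alternating (size gs).+1) sum_alternating.
have addr4 (a b x y : K) : a + b + (x + y) = y + b + x + a.
  by rewrite addrC (addrC a) (addrC x) addrACA addrA.
exact: addr4.
Qed.

(** The scalar [N%:R * mean P (U u)] contributed by the atoms is traded for
    the drift [c u], so that the same computation serves the sum of the atoms
    ([c u = V * mean P (U u)]) and its centered version ([c u = 0]). *)
Context (V : R) (c : I -> R) (A : I -> K -> K).
Hypothesis V0 : V != 0.
Hypothesis AE : forall u x,
  A u x = S u x + (c u * (N%:R / V) - N%:R * mean P (U u)) *: x.

Lemma atom_moment us gs : (forall g, g \in gs -> Q g) ->
  inner (run A us (spread gs)) (atom_vacuum K) =
  (moment U V^-1 (fun g => V * mean P g) c us gs).[N%:R / V].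
Proof.
have A_linear u : linear (A u).
  move=> a x y; rewrite !AE S_linear scalerDr scalerA mulrC -scalerA.
  by rewrite addrACA -scalerDr.
elim: us gs => [|u us IH] gs Qgs.
  rewrite /= inner_spread_vacuum; last by move=> g /Qgs/QL.
  by case: eqP => _; rewrite hornerC.
case: gs Qgs => [_|g gs Qgs].
  rewrite /run /= spread_nil AE atom_sum_vacuum addrAC -scalerDl addrC.
  rewrite [_ + (_ - _)]addrC subrK -/(run A us _) runD// runZ//.
  have IH0 := IH [::]; rewrite spread_nil in IH0.
  rewrite innerDl innerZl IH0// IH//; last first.
    by move=> g; rewrite inE => /eqP ->.
  by rewrite (center_recenter _ V0) !hornerE.
have Qg : Q g by apply: Qgs; rewrite mem_head.
have Qgs' h : h \in gs -> Q h by move=> hgs; apply: Qgs; rewrite inE hgs orbT.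
rewrite /run /= AE atom_sum_cons// addrAC [_ + _ + _ *: spread (g :: gs)]addrAC.
rewrite -/(run A us _) !runD// !runZ// !innerDl !innerZl !IH//; last 2 first.
- by move=> h; rewrite inE => /predU1P[->|/Qgs'//]; exact: QM.
- by move=> h; rewrite inE => /predU1P[->//|/Qgs].
rewrite !(center_recenter _ V0) !(hornerD, hornerN, hornerM, hornerZ, hornerX, hornerC).
rewrite mulKf//.
have -> x : V * x * (N%:R / V - V^-1 * (gs != [::])%:R)
    = x * (N%:R - (gs != [::])%:R) :> R.
  by rewrite [V^-1 * _]mulrC -mulrBl [V * x]mulrC -mulrA
    [V * (_ / V)]mulrC divfK.
rewrite -[in LHS](addrA _ _ (_ * mean P (U u) * _)) -mulrDl.
by rewrite mulrBl mul1r addrA subrK.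
Qed.

End moments.
End atom_space.

(** * Convergence of the moment polynomials *)

Lemma cvg_bigsum {R : realType} (J : Type) (r : seq J) (u : J -> nat -> R)
    (l : J -> R) :
  (forall j, u j n @[n --> \oo] --> l j) ->
  \sum_(j <- r) u j n @[n --> \oo] --> \sum_(j <- r) l j.
Proof.
move=> ul; elim: r => [|j r IH].
  by rewrite big_nil; under eq_fun do rewrite big_nil; exact: cvg_cst.
by rewrite big_cons; under eq_fun do rewrite big_cons; exact: cvgD.
Qed.

Section poly_convergence.
Context {R : realType}.
Implicit Types (p q : nat -> {poly R}).

(** Coefficientwise convergence; for bounded degrees this is the convergence
    of polynomials. *)
Definition coef_cvg p (l : {poly R}) := forall j, (p n)`_j @[n --> \oo] --> l`_j.

Lemma coef_cvg_cst (l : {poly R}) : coef_cvg (fun=> l) l.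
Proof. by move=> j; exact: cvg_cst. Qed.

Lemma coef_cvgD p q l m : coef_cvg p l -> coef_cvg q m ->
  coef_cvg (fun n => p n + q n) (l + m).
Proof.
move=> pl qm j; rewrite coefD; under eq_fun do rewrite coefD.
exact: cvgD.
Qed.

Lemma coef_cvgM p q l m : coef_cvg p l -> coef_cvg q m ->
  coef_cvg (fun n => p n * q n) (l * m).
Proof.
move=> pl qm j; rewrite coefM; under eq_fun do rewrite coefM.
by apply: cvg_bigsum => i; exact: cvgM.
Qed.

Lemma coef_cvgC (a : nat -> R) (b : R) : a n @[n --> \oo] --> b ->
  coef_cvg (fun n => (a n)%:P) b%:P.
Proof.
move=> ab j; rewrite coefC; under eq_fun do rewrite coefC.
by case: eqP => _ //; exact: cvg_cst.
Qed.

Lemma coef_cvgZ (a : nat -> R) (b : R) p l : a n @[n --> \oo] --> b ->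
  coef_cvg p l -> coef_cvg (fun n => a n *: p n) (b *: l).
Proof.
move=> ab pl; under eq_fun do rewrite -mul_polyC.
by rewrite -mul_polyC; apply: coef_cvgM => //; exact: coef_cvgC.
Qed.

Lemma coef_cvgB p q l m : coef_cvg p l -> coef_cvg q m ->
  coef_cvg (fun n => p n - q n) (l - m).
Proof.
move=> pl qm; apply: coef_cvgD => // j; rewrite coefN.
by under eq_fun do rewrite coefN; exact: cvgN.
Qed.

End poly_convergence.

Section moment_convergence.
Context {R : realType} {Y I : Type}.

(** One degree at most is gained per operator.  The bound does not depend on
    the functions, hence holds along the whole approximating sequence. *)
Lemma size_moment (U : I -> Y -> R) e J c us gs :
  (size (moment U e J c us gs) <= (size us).+1)%N.
Proof.
have sD (p q : {poly R}) m : (size p <= m)%N -> (size q <= m)%N ->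
    (size (p + q)%R <= m)%N.
  by move=> pm qm; rewrite (leq_trans (size_polyD _ _))// geq_max pm.
have sM (a b : R) (p : {poly R}) m : (size p <= m)%N ->
    (size ((a *: 'X + b%:P) * p)%R <= m.+1)%N.
  move=> pm; rewrite (leq_trans (size_polyMleq _ _))//.
  have s2 : (size (a *: 'X + b%:P)%R <= 2)%N.
    apply: (sD); last by rewrite (leq_trans (size_polyC_leq1 _)).
    by rewrite (leq_trans (size_scale_leq _ _))// size_polyX.
  by move: s2 pm; move: (size _) (size p) => x y; lia.
elim: us gs => [|u us IH] [|g gs] /=.
- by rewrite size_poly1.
- by rewrite size_poly0.
- apply: (sD); first exact: leqW.
  by rewrite -[_ *: 'X]addr0 -polyC0; exact: sM.
- apply: (sD); last first.
    by rewrite scalerBr -[_ *: _%:P]mul_polyC -polyCM -polyCN; exact: sM.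
  apply: (sD); last by rewrite -polyCN; exact: sM.
  by apply: (sD); exact: leqW.
Qed.

Context (U_ : nat -> I -> Y -> R) (U : I -> Y -> R) (e : nat -> R).
Context (J_ : nat -> (Y -> R) -> R) (J : (Y -> R) -> R).
Context (c_ : nat -> I -> R) (c : I -> R).
Context (Q : (nat -> Y -> R) -> (Y -> R) -> Prop).
Hypothesis e0 : e n @[n --> \oo] --> 0.
Hypothesis eJ : forall u, e n * J_ n (U_ n u) @[n --> \oo] --> 0.
Hypothesis c_c : forall u, c_ n u @[n --> \oo] --> c u.
Hypothesis QJ : forall u g_ g, Q g_ g ->
  J_ n (U_ n u \* g_ n) @[n --> \oo] --> J (U u \* g).
Hypothesis QU : forall u, Q (fun n => recenter (e n) (J_ n) (U_ n u)) (U u).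
Hypothesis QM : forall u g_ g, Q g_ g ->
  Q (fun n => recenter (e n) (J_ n) (U_ n u \* g_ n)) (U u \* g).

(** [Q g_ g] is any mode of convergence of [g_ n] to [g] that contains the
    symbols, is preserved by the recursion, and for which the scalars [J]
    produced by annihilation converge. *)
Lemma moment_cvg us (gs : seq ((nat -> Y -> R) * (Y -> R))) :
  (forall p, List.In p gs -> Q p.1 p.2) ->
  coef_cvg (fun n => moment (U_ n) (e n) (J_ n) (c_ n) us [seq p.1 n | p <- gs])
           (moment U 0 J c us [seq p.2 | p <- gs]).
Proof.
have r0 (g : Y -> R) : recenter 0 J g = g.
  by apply/funext => y; rewrite /recenter mul0r subr0.
elim: us gs => [|u us IH] gs Qgs.
  by case: gs {Qgs} => [|p gs]; exact: coef_cvg_cst.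
have cX : coef_cvg (fun n => c_ n u *: 'X) (c u *: 'X).
  by apply: coef_cvgZ => //; exact: coef_cvg_cst.
case: gs Qgs => [_|p gs Qgs] /=.
  apply: coef_cvgD; last by apply: coef_cvgM; [|exact: (IH [::])].
  rewrite r0.
  apply: (IH [:: (fun n => recenter (e n) (J_ n) (U_ n u), U u)]).
  by move=> _ [<-|//]; exact: QU.
have Qp := Qgs p (or_introl erefl).
have Qgs' q (qgs : List.In q gs) := Qgs q (or_intror qgs).
rewrite !r0; apply: coef_cvgD; last first.
  apply: coef_cvgM; last exact: IH.
  apply: coef_cvgZ; first exact: QJ.
  apply: coef_cvgB; first exact: coef_cvg_cst.
  apply: coef_cvgC; rewrite mul0r -[X in _ --> X](mul0r (gs != [::])%:R).
  have gsE n : ([seq p.1 n | p <- gs] != [::]) = (gs != [::]) by case: gs {Qgs Qgs'}.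
  under eq_fun do rewrite gsE.
  by apply: cvgM => //; exact: cvg_cst.
apply: coef_cvgD; last first.
  apply: coef_cvgM; last exact: (IH (p :: gs)).
  apply: coef_cvgB => //; apply: coef_cvgC; rewrite mul0r; exact: eJ.
apply: coef_cvgD.
  apply: (IH [:: (fun n => recenter (e n) (J_ n) (U_ n u), U u), p & gs]).
  by move=> q [<-|/Qgs//]; exact: QU.
apply: (IH ((fun n => recenter (e n) (J_ n) (U_ n u \* p.1 n), U u \* p.2) :: gs)).
by move=> q [<-|/Qgs'//]; exact: QM.
Qed.

End moment_convergence.

(** * Poisson averages of polynomials *)

Section poisson.
Context {R : realType}.
Implicit Types (a : R) (q : nat -> R).

Definition poisson_weight a N : R := a ^+ N / N`!%:R * expR (- a).

Lemma series_poisson_weight a : series (poisson_weight a) @ \oo --> (1 : R).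
Proof.
have -> : series (poisson_weight a) = fun n => expR (- a) * series (exp_coeff a) n.
  apply/funext => n; rewrite /series /= mulr_sumr.
  by apply: eq_bigr => i _; rewrite mulrC.
have -> : 1 = expR (- a) * expR a by rewrite -expRD addNr expR0.
apply: cvgM; first exact: cvg_cst.
rewrite expRE /= /pseries -exp_coeffE; exact: is_cvg_series_exp_coeff.
Qed.

(** The size-bias identity [E(N q(N)) = a E(q(N + 1))] of the Poisson law. *)
Lemma poisson_size_bias a q l :
  series (fun N => q N.+1 * poisson_weight a N) @ \oo --> l ->
  series (fun N => N%:R * q N * poisson_weight a N) @ \oo --> a * l.
Proof.
move=> ql; rewrite -cvg_shiftS.
have -> : [sequence series (fun N => N%:R * q N * poisson_weight a N) n.+1]_n =
    fun n => a * series (fun N => q N.+1 * poisson_weight a N) n.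
  apply/funext => n; rewrite /series /= big_nat_recl// !mul0r add0r mulr_sumr.
  apply: eq_bigr => i _; rewrite mulrAC mulrC [RHS]mulrCA; congr (_ * _).
  rewrite /poisson_weight factS natrM exprS invfM -!mulrA mulrCA.
  by congr (_ * _); rewrite mulrCA mulVKf// pnatr_eq0.
by apply: cvgM => //; exact: cvg_cst.
Qed.

(** The moments of [N / a] are the Touchard polynomials, reversed: polynomials
    in [1 / a] with constant term one. *)
Lemma poisson_moment j : exists T : {poly R}, T.[0] = 1 /\
  forall a, 0 < a ->
    series (fun N => (N%:R / a) ^+ j * poisson_weight a N) @ \oo --> T.[a^-1].
Proof.
elim/ltn_ind: j => -[_|j IH].
  exists 1; split; first by rewrite hornerC.
  move=> a _; rewrite hornerC.
  by under eq_fun do rewrite expr0 mul1r; exact: series_poisson_weight.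
have /choice[T TE] (i : 'I_j.+1) := IH i (ltn_ord i).
exists (\sum_(i < j.+1) 'C(j, i)%:R *: (T i * 'X^(j - i))); split.
  (* At [0] only the term [i = j], without a power of ['X], is left. *)
  rewrite horner_sum big_ord_recr /= big1 ?add0r.
    by rewrite binn subnn hornerZ hornerM (TE ord_max).1 hornerXn expr0 !mulr1.
  move=> i _; rewrite hornerZ hornerM hornerXn expr0n subn_eq0 leqNgt ltn_ord.
  by rewrite !mulr0.
move=> a a0; have a_neq0 : a != 0 by rewrite gt_eqF.
rewrite horner_sum.
have -> : (fun N => (N%:R / a) ^+ j.+1 * poisson_weight a N) =
    fun N => N%:R * (a^-1 * (N%:R / a) ^+ j) * poisson_weight a N.
  by apply/funext => N; rewrite exprS mulrA.
rewrite -[X in _ --> X](mulVKf a_neq0); apply: poisson_size_bias.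
rewrite mulr_sumr.
have -> : series (fun N => a^-1 * (N.+1%:R / a) ^+ j * poisson_weight a N) =
    fun n => \sum_(i < j.+1) a^-1 * ('C(j, i)%:R * a^-1 ^+ (j - i)) *
      series (fun N => (N%:R / a) ^+ i * poisson_weight a N) n.
  apply/funext => n; rewrite /series /=; under [RHS]eq_bigr do rewrite mulr_sumr.
  rewrite exchange_big; apply: eq_bigr => N _ /=.
  rewrite -natr1 mulrDl mul1r addrC exprDn mulr_sumr mulr_suml.
  by apply: eq_bigr => i _; rewrite -mulr_natl !mulrA.
apply: cvg_bigsum => i; rewrite hornerZ hornerM hornerXn.
rewrite [_.[_] * _]mulrC !mulrA; apply: cvgM; first exact: cvg_cst.
exact: (TE i).2.
Qed.

(** Under the Poisson law of a large parameter [a], the variable [N / a]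
    behaves as the constant [1]. *)
Lemma poisson_poly_cvg (p_ : nat -> {poly R}) (p : {poly R}) m (a : nat -> R) :
  (forall n, (size (p_ n) <= m)%N) -> coef_cvg p_ p ->
  (forall n, 0 < a n) -> (a n)^-1 @[n --> \oo] --> 0 ->
  limn (series (fun N => (p_ n).[N%:R / a n] * poisson_weight (a n) N))
    @[n --> \oo] --> p.[1].
Proof.
move=> sp pp a0 a_0.
have /choice[T TE] := poisson_moment.
have sm : (size p <= m)%N.
  apply/leq_sizeP => j mj.
  have : (p_ n)`_j @[n --> \oo] --> (0 : R).
    by under eq_fun do rewrite (nth_default _ (leq_trans (sp _) mj)); exact: cvg_cst.
  by move=> /(cvg_unique (@Rhausdorff R) (pp j)) ->.
have -> : (fun n => limn (series (fun N =>
      (p_ n).[N%:R / a n] * poisson_weight (a n) N))) =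
    fun n => \sum_(j < m) (p_ n)`_j * (T j).[(a n)^-1].
  apply/funext => n; apply/cvg_lim => //.
  have -> : series (fun N => (p_ n).[N%:R / a n] * poisson_weight (a n) N) =
      fun k => \sum_(j < m) (p_ n)`_j *
        series (fun N => (N%:R / a n) ^+ j * poisson_weight (a n) N) k.
    apply/funext => k; rewrite /series /=; under [RHS]eq_bigr do rewrite mulr_sumr.
    rewrite exchange_big; apply: eq_bigr => N _ /=.
    rewrite (horner_coef_wide _ (sp n)) mulr_suml.
    by apply: eq_bigr => i _; rewrite [RHS]mulrA.
  apply: cvg_bigsum => j; apply: cvgM; first exact: cvg_cst.
  exact: (TE j).2.
rewrite (horner_coef_wide _ sm); apply: cvg_bigsum => j; rewrite expr1n.
apply: cvgM; first exact: pp.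
rewrite -(TE j).1.
by have := cvg_comp _ _ a_0 (@continuous_horner _ (T j) 0); apply.
Qed.

End poisson.

(** * Integration off a null set *)

Lemma cvg0_le {R : realType} (u v : nat -> R) :
  (forall n, `|u n| <= v n) -> v n @[n --> \oo] --> 0 -> u n @[n --> \oo] --> 0.
Proof.
move=> uv v0; apply: (@squeeze_cvgr _ _ _ _ (fun n => - v n) v) => //.
  by apply: nearW => n; rewrite -ler_norml.
by rewrite -[X in _ --> X]oppr0; exact: cvgN.
Qed.

(** All bounds of the proof hold off one null set, that of the jumps larger
    than the bound of the Levy measure; naming it replaces the handling of
    almost everywhere statements. *)
Section null_set.
Context {R : realType} {d : measure_display} {Y : measurableType d}.
Context (mu : {measure set Y -> \bar R}) (Z : set Y).
Hypotheses (mZ : measurable Z) (Z0 : mu Z = 0%E).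

Lemma off_null_ae (p : Y -> Prop) : (forall y, ~ Z y -> p y) ->
  {ae mu, forall y, p y}.
Proof.
move=> Zp; exists Z; split => // y /= npy.
by apply: contrapT => /Zp.
Qed.

Lemma dominated_Rintegral_cvg (f_ : nat -> Y -> R) (f h : Y -> R) :
  (forall n, measurable_fun setT (f_ n)) -> measurable_fun setT f ->
  (forall y, ~ Z y -> f_ n y @[n --> \oo] --> f y) ->
  mu.-integrable setT (EFin \o h) ->
  (forall n y, ~ Z y -> `|f_ n y| <= h y) ->
  \int[mu]_y f_ n y @[n --> \oo] --> \int[mu]_y f y.
Proof.
move=> mf_ mf f_f ih f_h.
have [|||//||fi _ fcvg] := @dominated_convergence _ _ _ mu setT measurableT
    (fun n => EFin \o f_ n) (EFin \o f) (EFin \o h).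
- by move=> n; exact/measurable_EFinP.
- exact/measurable_EFinP.
- apply: off_null_ae => y Zy _; apply: cvg_EFin; first exact: nearW.
  exact: f_f.
- by apply: off_null_ae => y Zy n _; rewrite lee_fin f_h.
apply: fine_cvg; rewrite fineK//.
exact: (integrable_fin_num measurableT fi).
Qed.

Lemma integrable_off_null (D : set Y) (f h : Y -> R) : measurable D ->
  measurable_fun setT f -> mu.-integrable D (EFin \o h) ->
  (forall y, ~ Z y -> `|f y| <= h y) -> mu.-integrable D (EFin \o f).
Proof.
move=> mD mf ih fh.
have mfD : measurable_fun D (EFin \o f).
  by apply/measurable_EFinP; exact: measurable_funTS.
have [//|//||//||//] := @dominated_convergence _ _ _ mu D mD
    (fun=> EFin \o f) (EFin \o f) (EFin \o h).
- by apply: off_null_ae => y _ _; exact: cvg_cst.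
- by apply: off_null_ae => y Zy n _; rewrite lee_fin fh.
Qed.

Lemma le_Rintegral_off_null (D : set Y) (f h : Y -> R) : measurable D ->
  measurable_fun setT f -> mu.-integrable D (EFin \o h) ->
  (forall y, 0 <= h y) ->
  (forall y, ~ Z y -> `|f y| <= h y) ->
  `|\int[mu]_(y in D) f y| <= \int[mu]_(y in D) h y.
Proof.
move=> mD mf ih h0 fh.
have fi := integrable_off_null mD mf ih fh.
apply: (le_trans (le_normr_Rintegral mD fi)).
have fni : mu.-integrable D (EFin \o (fun y => `|f y|)) := integrable_norm fi.
rewrite /Rintegral fine_le ?integrable_fin_num//.
apply: ae_ge0_le_integral => //.
- exact: measurable_int fni.
- by move=> y _; rewrite lee_fin.
- exact: measurable_int ih.
- by apply: off_null_ae => y Zy _; rewrite lee_fin fh.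
Qed.

End null_set.

Lemma scaled_mean {R : realType} d (Y : measurableType d)
    (mu : {measure set Y -> \bar R}) (E : set Y) (V : R) (P : probability Y R)
    (g : Y -> R) : measurable E -> 0 < V ->
  (forall S, measurable S -> P S = (V^-1%:E * mu (S `&` E))%E) ->
  measurable_fun setT g ->
  V * mean P g = \int[mu]_(y in E) g y.
Proof.
move=> mE V0 PE mg.
have Vi0 : 0 <= V^-1 by rewrite invr_ge0 ltW.
have ge0E (h : Y -> \bar R) : measurable_fun setT h -> (forall y, 0 <= h y)%E ->
    (\int[P]_y h y = V^-1%:E * \int[mu]_(y in E) h y)%E.
  move=> mh h0.
  have PE0 : P (~` E) = 0%E.
    by rewrite PE ?setICl ?measure0 ?mule0//; exact: measurableC.
  rewrite (ge0_negligible_integral _ _ _ _ PE0)//; last exact: measurableC.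
  rewrite setTD setCK -(@ge0_integral_mscale _ _ _ mu _ mE (NngNum Vi0))//; last first.
    exact: measurable_funTS.
  apply: eq_measure_integral => A mA AE.
  by apply: (etrans (PE A mA)); rewrite /mscale /= (setIidl AE).
have mg' : measurable_fun setT (EFin \o g) by exact/measurable_EFinP.
rewrite /mean /Rintegral integralE [in RHS]integralE.
rewrite (ge0E _ (measurable_funepos mg'))// (ge0E _ (measurable_funeneg mg'))//.
move: (\int[mu]_(y in E) _)%E (\int[mu]_(y in E) _)%E => a b.
have Vi : 0 < V^-1 by rewrite invr_gt0.
have ky : (V^-1%:E * +oo = +oo :> \bar R)%E by rewrite gt0_muley ?lte_fin.
have kNy : (V^-1%:E * -oo = -oo :> \bar R)%E by rewrite gt0_muleNy ?lte_fin.
case: a => [a||]; case: b => [b||]; rewrite ?ky ?kNy /= ?mulr0//.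
by rewrite -mulrBr mulrA mulfV ?mul1r// gt_eqF.
Qed.

(** * Integrals over an exhausting sequence *)

(** [E n] exhausts the space and [J n] is the integral over [E n].  The symbols
    [U u] are bounded and of order [Phi], which is square integrable but
    whose integral over [E n] may grow, like [q n].  The weight [e n] of one
    atom is so small that [e n * q n ^+ 2] still vanishes in the limit. *)
Section approximation.
Context {R : realType} {d : measure_display} {Y : measurableType d}.
Context (mu : {measure set Y -> \bar R}) (Z : set Y).
Hypotheses (mZ : measurable Z) (Z0 : mu Z = 0%E).
Context (E : nat -> set Y) (J : nat -> (Y -> R) -> R).
Hypothesis mE : forall n, measurable (E n).
Hypothesis E_cover : forall y, \forall n \near \oo, E n y.
Hypothesis JE : forall n (g : Y -> R), measurable_fun setT g ->
  J n g = \int[mu]_(y in E n) g y.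
Context (Phi : Y -> R) (e q : nat -> R).
Hypothesis Phi0 : forall y, 0 <= Phi y.
Hypothesis Phi2 : mu.-integrable setT (EFin \o (fun y => Phi y ^+ 2)).
Hypothesis PhiE : forall n, mu.-integrable (E n) (EFin \o Phi).
Hypothesis Phiq : forall n, \int[mu]_(y in E n) Phi y <= q n.
Hypothesis e0 : forall n, 0 < e n.
Hypothesis e_0 : e n @[n --> \oo] --> 0.
Hypothesis cvg_e_mul_q2 : e n * q n ^+ 2 @[n --> \oo] --> 0.
Context {I : Type} (U : I -> Y -> R).
Hypothesis mU : forall u, measurable_fun setT (U u).
Hypothesis UPhi : forall u, exists2 C : R, 0 <= C &
  forall y, ~ Z y -> `|U u y| <= C /\ `|U u y| <= C * Phi y.

Let U_ n u := U u \_ (E n).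

Lemma q_ge0 n : 0 <= q n.
Proof. by apply: le_trans (Phiq n); apply: Rintegral_ge0. Qed.

(** [e * q <= e + e * q ^+ 2], by comparing [q] with [1]. *)
Lemma cvg_e_mul_q : e n * q n @[n --> \oo] --> 0.
Proof.
apply: (@cvg0_le _ _ (fun n => e n + e n * q n ^+ 2)); last first.
  by rewrite -[X in _ --> X](addr0 0); exact: cvgD.
move=> n; rewrite normrM (gtr0_norm (e0 n)) ger0_norm ?q_ge0//.
rewrite -[X in X + _]mulr1 -mulrDr ler_pM2l//.
have [q1|/ltW q1] := leP (q n) 1.
  by rewrite (le_trans q1)// lerDl sqr_ge0.
by rewrite (@le_trans _ _ (q n ^+ 2)) ?lerDr// expr2 ler_peMr ?q_ge0.
Qed.

Lemma integral_Phi_bound n (C : R) (g : Y -> R) : 0 <= C ->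
  measurable_fun setT g -> (forall y, ~ Z y -> `|g y| <= C * Phi y) ->
  `|J n g| <= C * q n.
Proof.
move=> C0 mg gC; rewrite JE//.
have iC : mu.-integrable (E n) (EFin \o (fun y => C * Phi y)).
  exact: (integrableZl (mE n) C (PhiE n)).
apply: (le_trans (le_Rintegral_off_null mZ Z0 _ mg iC _ gC)) => //.
  by move=> y; rewrite mulr_ge0.
by rewrite RintegralZl// ler_wpM2l.
Qed.

Lemma measurable_truncated n u : measurable_fun setT (U_ n u).
Proof. by apply/(measurable_restrictT _ (mE n)).1; exact: measurable_funTS. Qed.

Lemma truncated_le n u y : `|U_ n u y| <= `|U u y|.
Proof. by rewrite /U_ patchE; case: ifP => // _; rewrite normr0. Qed.

Lemma truncated_cvg u y : U_ n u y @[n --> \oo] --> U u y.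
Proof.
apply: cvg_near_cst; apply: filterS (E_cover y) => n Ey.
by rewrite /U_ patchE mem_set.
Qed.

(** The functions met along the recursion of [moment]: up to a constant that
    is small at the scale [e * q], they are dominated by [Phi] and
    convergent. *)
Definition tame (g_ : nat -> Y -> R) (g : Y -> R) := exists2 C : R, 0 <= C &
  exists phi : nat -> Y -> R, exists c : nat -> R,
  [/\ (forall n, measurable_fun setT (phi n)) /\ measurable_fun setT g,
      forall n y, ~ Z y -> `|phi n y| <= C * Phi y,
      forall y, ~ Z y -> phi n y @[n --> \oo] --> g y,
      forall n, g_ n = fun y => phi n y - c n &
      forall n, `|c n| <= C * (e n * q n)].

Lemma tame_recenter (C : R) (phi : nat -> Y -> R) (g : Y -> R) : 0 <= C ->
  (forall n, measurable_fun setT (phi n)) -> measurable_fun setT g ->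
  (forall n y, ~ Z y -> `|phi n y| <= C * Phi y) ->
  (forall y, ~ Z y -> phi n y @[n --> \oo] --> g y) ->
  tame (fun n => recenter (e n) (J n) (phi n)) g.
Proof.
move=> C0 mphi mg phiC phig; exists C => //.
exists phi, (fun n => e n * J n (phi n)); split => // n.
rewrite normrM (gtr0_norm (e0 n)) mulrCA ler_pM2l//.
by apply: integral_Phi_bound => // y; exact: phiC.
Qed.

Lemma tame_U u : tame (fun n => recenter (e n) (J n) (U_ n u)) (U u).
Proof.
have [C C0 UC] := UPhi u.
apply: (tame_recenter C0) => //.
- by move=> n; exact: measurable_truncated.
- by move=> n y /UC[_]; apply: le_trans; exact: truncated_le.
- by move=> y _; exact: truncated_cvg.
Qed.

(** The constant [c n] of [g_ n] times [U_ n u] is dominated by [Phi] as well,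
    so it joins the dominated part of the product, and only the mean of the
    product becomes the new constant. *)
Lemma tame_mul u g_ g : tame g_ g ->
  tame (fun n => recenter (e n) (J n) (U_ n u \* g_ n)) (U u \* g).
Proof.
move=> [C C0 [phi [c [[mphi mg] phiC phig g_E cC]]]].
have [C' C'0 UC] := UPhi u.
have [B [Breal BP]] := cvg_seq_bounded (cvgP _ cvg_e_mul_q).
pose B1 := Num.max (B + 1) 0.
have eqB n : e n * q n <= B1.
  have BB : B < B + 1 by rewrite ltrDl.
  rewrite (le_trans (ler_norm _))// (le_trans (BP _ BB n Logic.I))//.
  by rewrite le_max lexx.
have c_0 : c n @[n --> \oo] --> 0.
  apply: cvg0_le cC _; rewrite -[X in _ --> X](mulr0 C).
  by apply: cvgM; [exact: cvg_cst|exact: cvg_e_mul_q].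
have mg_ n : measurable_fun setT (g_ n).
  by rewrite g_E; apply: measurable_funB.
apply: (@tame_recenter (C' * C + C' * (C * B1))).
- by rewrite addr_ge0// !mulr_ge0// le_max lexx orbT.
- by move=> n; apply: measurable_funM => //; exact: measurable_truncated.
- exact: measurable_funM.
- move=> n y Zy; have [U1 U2] := UC y Zy.
  rewrite /= g_E mulrBr (le_trans (ler_normB _ _))// !normrM mulrDl lerD//.
    rewrite -mulrA ler_pM ?phiC// (le_trans (truncated_le _ _ _))//.
  rewrite mulrAC ler_pM// ?(le_trans (truncated_le _ _ _))// (le_trans (cC n))//.
  by rewrite ler_wpM2l.
- move=> y Zy; apply: cvgM; first exact: truncated_cvg.
  have -> : (fun n => g_ n y) = fun n => phi n y - c n.
    by apply/funext => n; rewrite g_E.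
  by rewrite -[g y]subr0; apply: cvgB => //; exact: phig.
Qed.

Lemma cvg_eJ u : e n * J n (U_ n u) @[n --> \oo] --> 0.
Proof.
have [C C0 UC] := UPhi u.
apply: (@cvg0_le _ _ (fun n => C * (e n * q n))); last first.
  rewrite -[X in _ --> X](mulr0 C).
  by apply: cvgM; [exact: cvg_cst|exact: cvg_e_mul_q].
move=> n; rewrite normrM (gtr0_norm (e0 n)) mulrCA ler_pM2l//.
apply: integral_Phi_bound => //; first exact: measurable_truncated.
by move=> y /UC[_]; apply: le_trans; exact: truncated_le.
Qed.

Lemma integral_truncated n u (h : Y -> R) :
  \int[mu]_(y in E n) (U_ n u y * h y) = \int[mu]_y (U_ n u y * h y).
Proof.
rewrite Rintegral_mkcond; apply: eq_Rintegral => y _.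
rewrite patchE; case: ifPn => // yE.
suff -> : U_ n u y = 0 by rewrite mul0r.
by rewrite /U_ patchE (negbTE yE).
Qed.

(** The dominated part converges with majorant [Phi ^+ 2]; the constant
    contributes [e * q] times an integral of order [q]. *)
Lemma cvg_J_mul u g_ g : tame g_ g ->
  J n (U_ n u \* g_ n) @[n --> \oo] --> \int[mu]_y (U u y * g y).
Proof.
move=> [C C0 [phi [c [[mphi mg] phiC phig g_E cC]]]].
have [C' C'0 UC] := UPhi u.
have iPhi2 := integrableZl measurableT (C' * C) Phi2.
have dom n y : ~ Z y -> `|U_ n u y * phi n y| <= C' * C * Phi y ^+ 2.
  move=> Zy; rewrite normrM expr2 mulrACA ler_pM ?phiC//.
  by rewrite (le_trans (truncated_le _ _ _))//; have [] := UC y Zy.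
have mUphi n : measurable_fun setT (fun y => U_ n u y * phi n y).
  by apply: measurable_funM => //; exact: measurable_truncated.
have iU n : mu.-integrable (E n) (EFin \o U_ n u).
  apply: (integrable_off_null mZ Z0 (mE n) (measurable_truncated n u)
    (h := fun y => C' * Phi y)).
    exact: (integrableZl (mE n) C' (PhiE n)).
  by move=> y /UC[_]; apply: le_trans; exact: truncated_le.
have -> : (fun n => J n (U_ n u \* g_ n)) =
    fun n => \int[mu]_y (U_ n u y * phi n y) - c n * J n (U_ n u).
  apply/funext => n; rewrite !JE; last 2 first.
  - exact: measurable_truncated.
  - rewrite g_E; apply: measurable_funM; first exact: measurable_truncated.
    exact: measurable_funB.
  rewrite -integral_truncated -RintegralZl// -RintegralB//.
  - by apply: eq_Rintegral => y _; rewrite /= g_E mulrBr [c n * _]mulrC.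
  - apply: (integrable_off_null mZ Z0 (mE n) (mUphi n) _ (dom n)).
    exact: integrableS iPhi2.
  - exact: (integrableZl (mE n) (c n) (iU n)).
rewrite -[X in _ --> X]subr0; apply: cvgB.
  apply: (dominated_Rintegral_cvg mZ Z0) iPhi2 _ => //.
  - exact: measurable_funM.
  - by move=> y Zy; apply: cvgM; [exact: truncated_cvg|exact: phig].
apply: (@cvg0_le _ _ (fun n => C * C' * (e n * q n ^+ 2))); last first.
  rewrite -[X in _ --> X](mulr0 (C * C')).
  by apply: cvgM => //; exact: cvg_cst.
move=> n; rewrite normrM expr2 (mulrA (e n)) mulrACA ler_pM//.
apply: integral_Phi_bound => //; first exact: measurable_truncated.
by move=> y /UC[_]; apply: le_trans; exact: truncated_le.
Qed.

(** The drift is an integral of a single symbol, so its majorant is [Phi]. *)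
Lemma cvg_J u : mu.-integrable setT (EFin \o Phi) ->
  J n (U_ n u) @[n --> \oo] --> \int[mu]_y U u y.
Proof.
move=> iPhi; have [C C0 UC] := UPhi u.
have -> : (fun n => J n (U_ n u)) = fun n => \int[mu]_y U_ n u y.
  apply/funext => n; rewrite JE; last exact: measurable_truncated.
  rewrite Rintegral_mkcond; apply: eq_Rintegral => y _.
  rewrite patchE; case: ifPn => // yE.
  by rewrite /U_ patchE (negbTE yE).
apply: (dominated_Rintegral_cvg mZ Z0) (integrableZl measurableT C iPhi) _ => //.
- by move=> n; exact: measurable_truncated.
- by move=> y _; exact: truncated_cvg.
- by move=> n y /UC[_]; apply: le_trans; exact: truncated_le.
Qed.

End approximation.

(** * Bounded functions, product integrals, and jump sizes *)

Lemma Lfun2_of_sqr {R : realType} d (Y : measurableType d)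
    (mu : {measure set Y -> \bar R}) (g : Y -> R) : measurable_fun setT g ->
  mu.-integrable setT (EFin \o (fun y => g y ^+ 2)) -> g \in Lfun mu 2%:E.
Proof.
move=> mg /integrableP[_ ig]; rewrite inE; apply/andP; split; rewrite inE//=.
rewrite /finite_norm unlock /Lnorm poweR_lty//=.
apply: le_lt_trans ig; rewrite le_eqVlt; apply/orP; left; apply/eqP.
apply: eq_integral => y _ /=.
by rewrite powR_mulrn// normrX.
Qed.

Section bounded_centered.
Context {R : realType} {d : measure_display} {Y : measurableType d}.
Context (P : probability Y R) (Z : set Y).
Hypotheses (mZ : measurable Z) (PZ : P Z = 0%E).

Definition bounded_off (g : Y -> R) := measurable_fun setT g /\
  exists2 C : R, 0 <= C & forall y, ~ Z y -> `|g y| <= C.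

Lemma bounded_off_integrable g : bounded_off g -> P.-integrable setT (EFin \o g).
Proof.
move=> [mg [C C0 gC]]; apply: (integrable_off_null mZ PZ measurableT mg) gC.
exact: finite_measure_integrable_cst.
Qed.

Lemma bounded_offM f g : bounded_off f -> bounded_off g -> bounded_off (f \* g).
Proof.
move=> [mf [B B0 fB]] [mg [C C0 gC]]; split; first exact: measurable_funM.
exists (B * C); first exact: mulr_ge0.
by move=> y Zy; rewrite /= normrM ler_pM// ?fB ?gC.
Qed.

Lemma bounded_off_center g : bounded_off g -> bounded_off (Defs.center P g).
Proof.
move=> [mg [C C0 gC]]; split; first exact: measurable_funB.
exists (C + `|mean P g|); first exact: addr_ge0.
by move=> y Zy; rewrite (le_trans (ler_normB _ _))// lerD2r gC.
Qed.

Lemma mean_center g : bounded_off g -> mean P (Defs.center P g) = 0.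
Proof.
move=> /bounded_off_integrable ig; rewrite /mean RintegralB//; last first.
  exact: finite_measure_integrable_cst.
rewrite Rintegral_cst// [fine _](_ : _ = 1) ?mulr1 ?subrr//.
exact: (congr1 fine (probability_setT P)).
Qed.

Lemma centered_L2_center g : bounded_off g -> centered_L2 (P := P) (Defs.center P g).
Proof.
move=> bg; split; last exact: mean_center.
have bc := bounded_off_center bg; apply: Lfun2_of_sqr; first by case: bc.
exact: bounded_off_integrable (bounded_offM bc bc).
Qed.

End bounded_centered.

(** Tonelli's theorem for the absolute value, then Fubini's. *)
Lemma integrable_tensor {R : realType} d1 d2 (X1 : measurableType d1)
    (X2 : measurableType d2) (m1 : {sigma_finite_measure set X1 -> \bar R})
    (m2 : {sigma_finite_measure set X2 -> \bar R}) (a : X1 -> R) (b : X2 -> R) :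
  m1.-integrable setT (EFin \o a) -> m2.-integrable setT (EFin \o b) ->
  (m1 \x m2)%E.-integrable setT (EFin \o (fun z => a z.1 * b z.2)) /\
  \int[(m1 \x m2)%E]_z (a z.1 * b z.2) = \int[m1]_x a x * \int[m2]_y b y.
Proof.
move=> ia ib.
have ma : measurable_fun setT a by apply/measurable_EFinP; exact: measurable_int ia.
have mb : measurable_fun setT b by apply/measurable_EFinP; exact: measurable_int ib.
have mab : measurable_fun setT (EFin \o (fun z : X1 * X2 => a z.1 * b z.2)).
  by apply/measurable_EFinP; apply: measurable_funM; exact: measurableT_comp.
have iab : (m1 \x m2)%E.-integrable setT (EFin \o (fun z => a z.1 * b z.2)).
  apply/integrable12ltyP => //.
  rewrite (eq_integral (fun x => `|(a x)%:E| * \int[m2]_y `|(b y)%:E|)%E); last first.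
    move=> x _; rewrite -ge0_integralZl//; last exact/measurable_EFinP/measurableT_comp.
    by apply: eq_integral => y _ /=; rewrite normrM EFinM.
  have [_ iaoo] := integrableP _ _ _ ia; have [_ iboo] := integrableP _ _ _ ib.
  rewrite ge0_integralZr//; last 2 first.
  - exact/measurable_EFinP/measurableT_comp.
  - exact: integral_ge0.
  by rewrite lte_mul_pinfty// ?integral_ge0// ge0_fin_numE ?integral_ge0.
split => //; rewrite {1}/Rintegral -integral12_prod_meas1//.
rewrite /fubini_F (eq_integral (fun x => (a x)%:E * (\int[m2]_y b y)%:E)%E); last first.
  by move=> x _; rewrite /Rintegral fineK -?integralZl// integrable_fin_num.
by rewrite integralZr// fineM// integrable_fin_num.
Qed.

Lemma measurable_Rstar_val (R : realType) :
  measurable_fun setT (@Rstar_val R : borel (Rstar R) -> R).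
Proof.
apply: (measurability _ (RGenOInfty.measurableE R)).
move=> _ [_ [x ->] <-]; rewrite setTI; apply: sub_sigma_algebra.
apply: open_comp; last exact: interval_open.
by move=> s _; exact: initial_continuous.
Qed.

Lemma measurable_far (R : realType) (r : R) :
  measurable ([set s | r < `|Rstar_val s|] : set (borel (Rstar R))).
Proof.
have mn : measurable_fun setT (fun s : borel (Rstar R) => `|Rstar_val s|).
  exact: measurableT_comp (@measurable_Rstar_val R).
have := mn measurableT `]r, +oo[%classic (measurable_itv _); rewrite setTI.
by congr measurable; apply/seteqP; split => s /=; rewrite in_itv /= andbT.
Qed.

(** * Convergence of the moments of the Poisson sum *)

(** The operators act componentwise, so the [N]-th term of the trace only sees
    the moment of [N] atoms. *)
Lemma poisson_trace_run {R : realType} d (Y : measurableType d)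
    (P : probability Y R) (alpha : R) (K : forall N, atomSpace P N) k
    (B : forall N, 'I_k -> K N -> K N) :
  poisson_trace alpha (op_prod (fun i => poisson_op (fun N => B N i))) =
  limn (series (fun N =>
    inner (run (B N) (rev (index_enum 'I_k)) (atom_vacuum (K N)))
          (atom_vacuum (K N)) * poisson_weight alpha N)).
Proof.
rewrite /poisson_trace; congr (limn (series _)); apply/funext => N.
congr (inner _ _ * _); rewrite -op_prod_run.
have opN (x : atom_seq K) :
    op_prod (fun i => poisson_op (fun N => B N i)) x N = op_prod (B N) (x N).
  rewrite /op_prod; elim: (index_enum _) x => [|i s IH] x; first by rewrite !big_nil.
  by rewrite !big_cons /= /poisson_op IH.
by rewrite opN /atom_vacuum_at dfwithin.
Qed.

Section levy_limit.
Context {R : realType} {X : ptopologicalType}.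
Context {sigma : {measure set (borel X) -> \bar R}}.
Hypotheses (hrad : radon sigma) (hinf : sigma setT = +oo%E).
Context {nu : {sigma_finite_measure set (borel (Rstar R)) -> \bar R}}.
Context (r : R).
Hypotheses (r0 : 0 < r) (hnu : nu [set s | r < `|Rstar_val s|] = 0%E).
Hypothesis s2 : nu.-integrable setT (fun s => (Rstar_val s ^+ 2)%:E).
Context {Lambda : nat -> set X} {Delta : nat -> set (Rstar R)}.
Hypothesis hL0 : forall n, B0 (Lambda n).
Hypothesis hLm : forall n, Lambda n `<=` Lambda n.+1.
Hypothesis hLU : \bigcup_n Lambda n = setT.
Hypothesis hD0 : forall n, B0 (Delta n).
Hypothesis hDm : forall n, Delta n `<=` Delta n.+1.
Hypothesis hDU : \bigcup_n Delta n = setT.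
Context {V : nat -> R}.
Hypothesis hV : forall n, (sigma (Lambda n) * nu (Delta n))%E = (V n)%:E.
Hypothesis hV0 : forall n, 0 < V n.

Local Notation Y := (borel X * borel (Rstar R))%type.
Local Notation mu := (sigma \x nu)%E.

Let a n := fine (sigma (Lambda n)).
Let b n := fine (nu (Delta n)).

Let mLambda n : measurable (Lambda n : set (borel X)). Proof. by case: (hL0 n). Qed.
Let mDelta n : measurable (Delta n : set (borel (Rstar R))).
Proof. by case: (hD0 n). Qed.

Let aE n : sigma (Lambda n) = (a n)%:E.
Proof. by rewrite /a fineK// ge0_fin_numE// hrad. Qed.

Let bE n : nu (Delta n) = (b n)%:E.
Proof.
(* An infinite factor would make the product [V n] infinite or zero. *)
rewrite /b fineK// ge0_fin_numE// ltey; apply/eqP => nuoo.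
have := hV n; rewrite aE nuoo mulry => VE; have := hV0 n.
case: (ltgtP (a n) 0) VE => [a0|a0|->]; last by rewrite sgr0 mul0e => -[<-]; rewrite ltxx.
- by rewrite ltr0_sg// mulN1e.
- by rewrite gtr0_sg// mul1e.
Qed.

Let VE n : V n = a n * b n.
Proof. by apply: EFin_inj; rewrite -hV aE bE EFinM. Qed.

Let a0 n : 0 < a n.
Proof.
have a_ge0 : 0 <= a n by rewrite fine_ge0.
rewrite lt_neqAle a_ge0 andbT; apply/eqP => a_eq0.
by have := hV0 n; rewrite VE -a_eq0 mul0r ltxx.
Qed.

Let b0 n : 0 < b n.
Proof. by have := hV0 n; rewrite VE pmulr_rgt0. Qed.

Let ndL : nondecreasing_seq Lambda.
Proof. by apply/nondecreasing_seqP => n; exact/subsetPset. Qed.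

Let ndD : nondecreasing_seq Delta.
Proof. by apply/nondecreasing_seqP => n; exact/subsetPset. Qed.

(** The only place where the infinite mass of [sigma] enters. *)
Let cvg_aV : (a n)^-1 @[n --> \oo] --> 0.
Proof.
have aoo : (a n)%:E @[n --> \oo] --> +oo%E.
  have := @nondecreasing_cvg_mu _ (borel X) _ sigma Lambda mLambda _ ndL.
  rewrite hLU hinf => /(_ measurableT).
  by have -> : sigma \o Lambda = fun n => (a n)%:E by apply/funext => n /=.
apply: (@gtr0_cvgV0 _ _ _ _ a _).2; first exact: nearW.
exact/cvgeryP.
Qed.

Let bV n : (b n)^-1 <= (b 0%N)^-1.
Proof.
rewrite lef_pV2 ?posrE// -lee_fin -!bE le_measure ?inE//.
exact/subsetPset/ndD.
Qed.

Let cvg_V : (V n)^-1 @[n --> \oo] --> 0.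
Proof.
apply: (@cvg0_le _ _ (fun n => (a n)^-1 * (b 0%N)^-1)).
  move=> n; rewrite VE invfM normrM !gtr0_norm ?invr_gt0//.
  by rewrite ler_pM2l ?invr_gt0.
rewrite -[X in _ --> X](mul0r (b 0%N)^-1).
by apply: cvgM => //; exact: cvg_cst.
Qed.

Let E n : set Y := Lambda n `*` Delta n.

Let mE n : measurable (E n). Proof. exact: measurableX. Qed.

Let E_cover (y : Y) : \forall n \near \oo, E n y.
Proof.
have [n1 _ L1] : (\bigcup_n Lambda n) y.1 by rewrite hLU.
have [n2 _ D2] : (\bigcup_n Delta n) y.2 by rewrite hDU.
exists (maxn n1 n2) => // n /=; rewrite geq_max => /andP[n1n n2n].
by split; [apply: (subsetPset _ _ (ndL n1n))|apply: (subsetPset _ _ (ndD n2n))].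
Qed.

Let mval := @measurable_Rstar_val R.

Let Z : set Y := setT `*` [set s | r < `|Rstar_val s|].

Let mfar := @measurable_far R r.

Let mZ : measurable Z.
Proof.
apply: measurableX => //; exact: mfar.
Qed.

Let Z0 : mu Z = 0%E.
Proof. by rewrite /Z product_measure1E// hnu mule0. Qed.

Let sigma_finite_sigma : sigma_finite setT sigma.
Proof. by exists Lambda => // n; split; [exact: mLambda|exact: hrad]. Qed.

Let integrable_product (g : X -> R) (h : Rstar R -> R) :
  sigma.-integrable setT (EFin \o (g : borel X -> R)) ->
  nu.-integrable setT (EFin \o (h : borel (Rstar R) -> R)) ->
  mu.-integrable setT (EFin \o (fun z : Y => g z.1 * h z.2)) /\
  \int[mu]_(z in [set: Y]) (g z.1 * h z.2) =
    \int[sigma]_x (g : borel X -> R) x * \int[nu]_s (h : borel (Rstar R) -> R) s.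
Proof.
(* The product measure is formed from [sigma] as a mere measure; Fubini's
   theorem takes the same function with its sigma-finiteness attached. *)
pose sf := isSFinite.Build _ _ _ _ (sfinite_measure_sigma_finite sigma_finite_sigma).
pose fs := isSigmaFinite.Build _ _ _ _ sigma_finite_sigma.
pose sigma' := HB.pack_for (SigmaFiniteMeasure.type (borel X) R)
  (Measure.sort sigma) sf fs.
exact: (@integrable_tensor R _ _ _ _ sigma' nu g h).
Qed.

Context {P : nat -> probability Y R}.
Hypothesis hP : forall n S, measurable S ->
  P n S = ((V n)^-1%:E * mu (S `&` E n))%E.
Context {k : nat} (f : 'I_k -> X -> R).
Hypothesis hf : forall i, B0fun (f i).

Let support i : set X := [set x | f i x != 0].
Let L : set X := \big[setU/set0]_(i < k) support i.

Let mf i : measurable_fun [set: borel X] (f i : borel X -> R).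
Proof. by case: (hf i). Qed.

Let f_support i x : f i x != 0 -> L x.
Proof. by move=> fx; rewrite /L (bigD1 i)//=; left. Qed.

Let msupport i : measurable (support i : set (borel X)).
Proof.
have := mf i measurableT (measurableC (measurable_set1 0)); rewrite setTI.
by congr measurable; apply/seteqP; split => x /= /eqP.
Qed.

Let L_finite : measurable (L : set (borel X)) /\ (sigma L < +oo)%E.
Proof.
apply: (big_ind (fun A : set (borel X) => measurable A /\ (sigma A < +oo)%E)).
- by split; [exact: measurable0|rewrite measure0].
- move=> A B [mA Aoo] [mB Boo]; split; first exact: measurableU.
  by rewrite (le_lt_trans (measureU2 _ mA mB))// lte_add_pinfty.
- move=> i _; split; first exact: msupport.
  by apply: hrad; split; [exact: msupport|case: (hf i)].
Qed.

Let integrable_indicator d (T : measurableType d)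
    (m : {measure set T -> \bar R}) (A : set T) :
  measurable A -> (m A < +oo)%E ->
  m.-integrable setT (EFin \o (\1_A : T -> R)).
Proof.
move=> mA Aoo; apply/integrableP; split; first exact/measurable_EFinP.
under eq_integral => x _ do rewrite /= ger0_norm//.
by rewrite integral_indic// setIT.
Qed.

Let Phi (z : Y) : R := \1_L z.1 * `|Rstar_val z.2|.

Let mPhi : measurable_fun setT Phi.
Proof.
have mL : measurable_fun setT (\1_L : borel X -> R).
  by apply: measurable_indic; case: L_finite.
apply: measurable_funM; first exact: (measurableT_comp mL measurable_fst).
exact: (measurableT_comp _ (measurableT_comp mval measurable_snd)).
Qed.

Let Phi0 z : 0 <= Phi z. Proof. by rewrite mulr_ge0. Qed.

Let indicL := integrable_indicator L_finite.1 L_finite.2.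

Let Phi2 : mu.-integrable setT (EFin \o (fun z => Phi z ^+ 2)).
Proof.
have [+ _] := integrable_product indicL s2.
congr (_.-integrable _ _); apply/funext => z /=; congr EFin.
rewrite /Phi exprMn real_normK ?num_real//; congr (_ * _).
by rewrite indicE; case: (_ \in _); rewrite ?expr1n ?expr0n.
Qed.

Let S2 := \int[mu]_(z in [set: Y]) (Phi z ^+ 2).
Let kappa := \int[sigma]_x (\1_L : borel X -> R) x.
Let q n := (S2 + kappa) * Num.sqrt (b n).

(** Young's inequality [x <= t * x ^+ 2 + t^-1], with the [t] that balances
    the two integrals over the set where [Phi] does not vanish. *)
Let Phi_le n z : (Phi \_ (E n)) z <= Num.sqrt (b n) * Phi z ^+ 2 +
  (Num.sqrt (b n))^-1 * (\1_L z.1 * \1_(Delta n) z.2).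
Proof.
have t0 : 0 < Num.sqrt (b n) by rewrite sqrtr_gt0.
have rhs0 : 0 <= Num.sqrt (b n) * Phi z ^+ 2 +
    (Num.sqrt (b n))^-1 * (\1_L z.1 * \1_(Delta n) z.2).
  by rewrite addr_ge0// !mulr_ge0 ?sqr_ge0 ?invr_ge0 ?(ltW t0).
rewrite patchE; case: ifPn => [|_]; last exact: rhs0.
rewrite inE => -[_ /= zD]; move: rhs0; rewrite (indicE _ (Delta n)) mem_set// mulr1.
rewrite /Phi indicE; case: (_ \in L); rewrite ?mul0r// !mul1r mulr1 => _.
set t := Num.sqrt _ in t0 *; set x := `|_|.
have [xt|xt] := leP x t^-1.
  by rewrite (le_trans xt)// lerDr mulr_ge0 ?sqr_ge0// ltW.
rewrite (@le_trans _ _ (t * x ^+ 2))// ?lerDl ?invr_ge0 ?(ltW t0)//.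
have x0 : 0 <= x by exact: normr_ge0.
rewrite expr2 mulrA ler_peMl// -(mulfV (lt0r_neq0 t0)) ler_pM2l//.
exact: ltW.
Qed.

Let integrable_Young n : mu.-integrable setT (EFin \o (fun z =>
  Num.sqrt (b n) * Phi z ^+ 2 +
  (Num.sqrt (b n))^-1 * (\1_L z.1 * \1_(Delta n) z.2))).
Proof.
have Doo : (nu (Delta n) < +oo)%E by rewrite bE ltry.
have [iLD _] := integrable_product indicL (integrable_indicator (mDelta n) Doo).
exact: (integrableD measurableT (integrableZl measurableT _ Phi2)
  (integrableZl measurableT _ iLD)).
Qed.

Let restrict_PhiE n : mu.-integrable setT (EFin \o (Phi \_ (E n))).
Proof.
apply: (le_integrable measurableT _ _ (integrable_Young n)).
  have := (measurable_restrictT Phi (mE n)).1 (measurable_funTS mPhi).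
  by move=> /measurable_EFinP.
move=> z _ /=; rewrite lee_fin ger0_norm; last first.
  by rewrite patchE; case: ifP => // _; exact: Phi0.
by rewrite (le_trans (Phi_le n z))// ler_norm.
Qed.

Let PhiE n : mu.-integrable (E n) (EFin \o Phi).
Proof.
apply/(integrable_mkcond _ (mE n)); rewrite restrict_EFin.
exact: restrict_PhiE.
Qed.

Let Phiq n : \int[mu]_(z in E n) Phi z <= q n.
Proof.
rewrite Rintegral_mkcond.
apply: (le_trans (le_Rintegral measurableT (restrict_PhiE n) (integrable_Young n)
  (fun z _ => Phi_le n z))).
have Doo : (nu (Delta n) < +oo)%E by rewrite bE ltry.
have [iLD ILD] := integrable_product indicL (integrable_indicator (mDelta n) Doo).
rewrite RintegralD//; last 2 first.
- exact: (integrableZl measurableT _ Phi2).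
- exact: (integrableZl measurableT _ iLD).
rewrite !RintegralZl// ILD /q mulrDl [S2 * _]mulrC lerD2l.
have -> : \int[nu]_s (\1_(Delta n) : borel (Rstar R) -> R) s = b n.
  by rewrite /Rintegral integral_indic// setIT.
rewrite mulrCA -{2}(sqr_sqrtr (ltW (b0 n))) expr2 mulKf//.
by rewrite gt_eqF// sqrtr_gt0.
Qed.

Let cvg_e_mul_q2 : (V n)^-1 * q n ^+ 2 @[n --> \oo] --> 0.
Proof.
have -> : (fun n => (V n)^-1 * q n ^+ 2) = fun n => (a n)^-1 * (S2 + kappa) ^+ 2.
  apply/funext => n; rewrite /q exprMn sqr_sqrtr ?(ltW (b0 n))// VE invfM -mulrA.
  by congr (_ * _); rewrite mulrC mulfK ?gt_eqF.
rewrite -[X in _ --> X](mul0r ((S2 + kappa) ^+ 2)).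
by apply: cvgM => //; exact: cvg_cst.
Qed.

Let U i : Y -> R := otimes_id (f i).

Let mU i : measurable_fun setT (U i).
Proof.
apply: measurable_funM; first exact: (measurableT_comp (mf i) measurable_fst).
exact: (measurableT_comp mval measurable_snd).
Qed.

Let f_bounded i : exists2 M : R, 0 <= M & forall x, `|f i x| <= M.
Proof.
have [_ [M [_ fM]] _] := hf i.
exists (`|M| + 1); first by rewrite addr_ge0.
by move=> x; apply: fM => //; rewrite (le_lt_trans (ler_norm _))// ltrDl.
Qed.

Let U_Phi i : exists2 C : R, 0 <= C &
  forall z, ~ Z z -> `|U i z| <= C /\ `|U i z| <= C * Phi z.
Proof.
have [M M0 fM] := f_bounded i; exists (M * (1 + r)).
  by rewrite mulr_ge0// addr_ge0// ltW.
move=> z Zz; rewrite /U /otimes_id normrM; split.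
  have zr : `|Rstar_val z.2| <= r.
    by rewrite leNgt; apply/negP => rz; apply: Zz; split.
  by rewrite ler_pM// (le_trans zr)// lerDr.
have [fz0|fz0] := eqVneq (f i z.1) 0.
  by rewrite fz0 normr0 mul0r mulr_ge0// mulr_ge0// addr_ge0// ltW.
rewrite /Phi indicE mem_set ?mul1r; last exact: f_support fz0.
by rewrite ler_wpM2r// (le_trans (fM _))// ler_peMr// lerDl ltW.
Qed.

Context {K : forall n N, atomSpace (P n) N} {F : fockSpace mu}.

Let U_ n i : Y -> R := otimes_id_on (Lambda n) (Delta n) (f i).
Let J n (g : Y -> R) := V n * mean (P n) g.

Let JE n (g : Y -> R) : measurable_fun setT g ->
  J n g = \int[mu]_(z in E n) g z.
Proof. exact: (scaled_mean (mE n) (hV0 n) (hP n)). Qed.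

Let e0 n : 0 < (V n)^-1. Proof. by rewrite invr_gt0. Qed.

Let PZ n : P n Z = 0%E.
Proof.
rewrite hP//; suff -> : mu (Z `&` E n) = 0%E by rewrite mule0.
by apply: (subset_measure0 _ mZ _ Z0) => //; exact: measurableI.
Qed.

Let bU n i : bounded_off Z (U_ n i).
Proof.
split; first exact: (measurable_truncated mE mU n i).
have [C C0 UC] := U_Phi i; exists C => // z /UC[+ _].
by apply: le_trans; exact: (truncated_le E U n i z).
Qed.

Lemma centered_otimes_id_on n i :
  centered_L2 (P := P n) (Defs.center (P n) (U_ n i)).
Proof. exact: (centered_L2_center mZ (PZ n) (bU n i)). Qed.

Lemma cvg_drift : nu.-integrable setT (fun s => (Rstar_val s)%:E) -> forall i,
  V n * mean (P n) (U_ n i) @[n --> \oo] -->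
  \int[sigma]_x (f i : borel X -> R) x * \int[nu]_s Rstar_val s.
Proof.
move=> s1 i; have [M M0 fM] := f_bounded i.
have fi : sigma.-integrable setT (EFin \o (f i : borel X -> R)).
  apply: (le_integrable measurableT _ _ (integrableZl measurableT M indicL)).
    exact/measurable_EFinP.
  move=> x _; rewrite /= lee_fin indicE.
  have [fx0|/f_support/mem_set ->] := eqVneq (f i x) 0.
    by rewrite fx0 normr0.
  by rewrite mulr1 (ger0_norm M0).
have <- : \int[mu]_(z in [set: Y]) U i z =
    \int[sigma]_x (f i : borel X -> R) x * \int[nu]_s Rstar_val s.
  exact: (integrable_product fi s1).2.
apply: (cvg_J mZ Z0 mE E_cover JE mU U_Phi).
have s1' : nu.-integrable setT (EFin \o (fun s : borel (Rstar R) => `|Rstar_val s|)).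
  exact: integrable_norm.
exact: (integrable_product indicL s1').1.
Qed.

(** The common form of both limits: [c_ n i] and [c i] are the drifts, that is
    the expectations of the approximating and of the limiting noise. *)
Lemma poisson_trace_cvg (c_ : nat -> 'I_k -> R) (c : 'I_k -> R)
    (B : forall n N, 'I_k -> K n N -> K n N) (A : 'I_k -> F -> F) :
  (forall n N i, exists M : 'I_N -> K n N -> K n N,
     (forall j, is_atom_operator j (U_ n i) (M j)) /\
     forall x, B n N i x = \sum_j M j x
       + (c_ n i * (N%:R / V n) - N%:R * mean (P n) (U_ n i)) *: x) ->
  (forall i, exists ap a0 am : F -> F,
     [/\ is_creation (U i) ap, is_preservation (U i) a0,
         is_annihilation (U i) am &
         A i = fun x => ap x + a0 x + am x + c i *: x]) ->
  (forall i, c_ n i @[n --> \oo] --> c i) ->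
  poisson_trace (V n) (op_prod (fun i => poisson_op (fun N => B n N i)))
    @[n --> \oo] --> fock_trace (op_prod A).
Proof.
move=> BE AE c_c; pose us := rev (index_enum 'I_k).
have -> : (fun n => poisson_trace (V n)
      (op_prod (fun i => poisson_op (fun N => B n N i)))) =
    fun n => limn (series (fun N =>
      (moment (U_ n) (V n)^-1 (J n) (c_ n) us [::]).[N%:R / V n]
      * poisson_weight (V n) N)).
  apply/funext => n; rewrite poisson_trace_run; congr (limn (series _)).
  apply/funext => N; congr (_ * _).
  have /choice[M ME] := BE n N.
  (* Centered functions are kept as the centerings of bounded ones, from
     which square integrability and zero mean follow. *)
  pose Q (g : Y -> R) := exists2 h, bounded_off Z h & g = Defs.center (P n) h.
  have QL g : Q g -> centered_L2 (P := P n) g.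
    by move=> [h bh ->]; exact: (centered_L2_center mZ (PZ n)).
  have QU i : Q (Defs.center (P n) (U_ n i)) by exists (U_ n i).
  have QM i g : Q g -> Q (Defs.center (P n) (U_ n i \* g)).
    move=> [h bh ->]; exists (U_ n i \* Defs.center (P n) h) => //.
    by apply: bounded_offM => //; exact: bounded_off_center.
  have := @atom_moment _ _ _ _ _ _ _ _ _ QL QU QM _ (fun i => (ME i).1) _ _ _
    (lt0r_neq0 (hV0 n)) (fun i => (ME i).2) us [::].
  by rewrite spread_nil; exact.
pose Q (g : Y -> R) := measurable_fun setT g /\
  exists2 C : R, 0 <= C & forall z, ~ Z z -> `|g z| <= C * Phi z.
have -> : fock_trace (op_prod A) =
    (moment U 0 (fun g => \int[mu]_z g z) c us [::]).[1].
  have QL g : Q g -> g \in Lfun mu 2%:E.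
    move=> [mg [C C0 gC]]; apply: Lfun2_of_sqr => //.
    apply: (integrable_off_null mZ Z0 measurableT _
      (integrableZl measurableT (C ^+ 2) Phi2)); first exact: measurable_funX.
    by move=> z /gC gz; rewrite normrX -exprMn lerXn2r ?nnegrE// mulr_ge0.
  have QU i : Q (U i).
    by split; [exact: mU|have [C C0 UC] := U_Phi i; exists C => // z /UC[]].
  have QM i g : Q g -> Q (U i \* g).
    move=> [mg [C C0 gC]]; split; first exact: measurable_funM.
    have [C' C'0 UC] := U_Phi i; exists (C' * C); first exact: mulr_ge0.
    by move=> z Zz; rewrite /= normrM -mulrA ler_pM ?gC//; case: (UC z Zz).
  by rewrite /fock_trace op_prod_run -/us (fock_moment QL QU QM AE).
apply: poisson_poly_cvg.
- by move=> n; exact: size_moment.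
- move=> j; apply: (moment_cvg (Q := tame Z Phi (fun n => (V n)^-1) q)
    (e := fun n => (V n)^-1) cvg_V _ c_c _ _ _ (us := us) (gs := [::])) => //.
  + exact: (cvg_eJ mZ Z0 mE JE Phi0 PhiE Phiq e0 cvg_V cvg_e_mul_q2 mU U_Phi).
  + exact: (cvg_J_mul mZ Z0 mE E_cover JE Phi0 Phi2 PhiE Phiq cvg_e_mul_q2 mU U_Phi).
  + exact: (tame_U mZ Z0 mE E_cover JE Phi0 PhiE Phiq e0 mU U_Phi).
  + exact: (tame_mul mZ Z0 mE E_cover JE Phi0 PhiE Phiq e0 cvg_V cvg_e_mul_q2 mU U_Phi).
- exact: hV0.
- exact: cvg_V.
Qed.

End levy_limit.

Lemma atom_trace_sum {R : realType} d (Y : measurableType d)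
    (P : probability Y R) N (K : atomSpace P N) (u : Y -> R)
    (M : 'I_N -> K -> K) : centered_L2 (P := P) (Defs.center P u) ->
  (forall i, is_atom_operator i u (M i)) ->
  atom_trace (fun x => \sum_i M i x) = N%:R * mean P u.
Proof.
move=> Lu ME.
rewrite /atom_trace (@atom_sum_vacuum _ _ _ _ _ _ unit (fun=> u) _ (fun=> ME) tt).
rewrite innerDl innerZl inner_spread_vacuum; last by move=> g; rewrite inE => /eqP ->.
by rewrite -{1}spread_nil inner_spread_vacuum//= mulr1 addr0.
Qed.

Theorem corollary17 (R : realType) (X : ptopologicalType)
  (hXlc : locally_compact [set: X]) (hXpol : polish R X)
  (sigma : {measure set (borel X) -> \bar R})
  (hrad : radon sigma) (hna : nonatomic sigma) (hinf : sigma setT = +oo%E)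
  (nu : {sigma_finite_measure set (borel (Rstar R)) -> \bar R})
  (hnu : exists2 r : R, 0 < r & nu [set s | r < `|Rstar_val s|] = 0%E)
  (Lambda : nat -> set X) (Delta : nat -> set (Rstar R))
  (hL0 : forall n, B0 (Lambda n)) (hLm : forall n, Lambda n `<=` Lambda n.+1)
  (hLU : \bigcup_n Lambda n = setT)
  (hD0 : forall n, B0 (Delta n)) (hDm : forall n, Delta n `<=` Delta n.+1)
  (hDU : \bigcup_n Delta n = setT)
  (V : nat -> R)
  (hV : forall n, (sigma (Lambda n) * nu (Delta n))%E = (V n)%:E)
  (hV0 : forall n, 0 < V n)
  (P : nat -> probability (borel X * borel (Rstar R))%type R)
  (hP : forall n S, measurable S ->
     P n S = ((V n)^-1%:E * (sigma \x nu) (S `&` (Lambda n `*` Delta n)))%E)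
  (K : forall n N, atomSpace (P n) N)
  (A_ : forall n N, (X -> R) -> K n N -> K n N)
  (hA_ : forall n N (f : X -> R), B0fun f ->
     is_atom_sum (otimes_id_on (Lambda n) (Delta n) f) (A_ n N f))
  (F : fockSpace (sigma \x nu)%E) :
  (forall A : (X -> R) -> F -> F,
     nu.-integrable setT (fun s => (Rstar_val s)%:E) ->
     is_levy_noise A ->
     forall (k : nat) (f : 'I_k -> X -> R), (0 < k)%N ->
       (forall i, B0fun (f i)) ->
       poisson_trace (V n) (op_prod (fun i =>
           poisson_op (fun N => A_ n N (f i)))) @[n --> \oo]
         --> fock_trace (op_prod (fun i => A (f i))))
  /\
  (forall At : (X -> R) -> F -> F,
     nu.-integrable setT (fun s => (Rstar_val s ^+ 2)%:E) ->
     is_centered_levy_noise At ->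
     forall (k : nat) (f : 'I_k -> X -> R), (0 < k)%N ->
       (forall i, B0fun (f i)) ->
       poisson_trace (V n) (op_prod (fun i =>
           poisson_op (fun N => centered_op (A_ n N (f i))))) @[n --> \oo]
         --> fock_trace (op_prod (fun i => At (f i)))).
Proof.
have [r r0 nur] := hnu; split.
- move=> A s1 [At hAt hA] k f _ hf.
  have mfar := measurable_far (R := R) r.
  (* [s ^ 2 <= r |s|] off the null set of the jumps larger than [r]. *)
  have s2 : nu.-integrable setT (fun s => (Rstar_val s ^+ 2)%:E).
    have mv := @measurable_Rstar_val R.
    have s1' : nu.-integrable setT (EFin \o (fun s : borel (Rstar R) => `|Rstar_val s|)).
      exact: integrable_norm.
    apply: (integrable_off_null mfar nur measurableT
      (measurable_funX 2 mv) (integrableZl measurableT r s1')).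
    move=> s /negP; rewrite -leNgt => sr.
    by rewrite /= normrX expr2 ler_wpM2r.
  apply: (poisson_trace_cvg hrad hinf r0 nur s2 hL0 hLm hLU hD0 hDm hDU hV hV0 hP hf
    (c_ := fun n i => V n * mean (P n) (otimes_id_on (Lambda n) (Delta n) (f i)))
    (c := fun i => \int[sigma]_x (f i x : R) * \int[nu]_s Rstar_val s)
    (B := fun n N i => A_ n N (f i))) => [n N i|i|i].
  + have [M ME ->] := hA_ n N (f i) (hf i).
    exists M; split=> // x.
    rewrite [V n * _ * _]mulrC -mulrA mulKf ?gt_eqF//.
    by rewrite subrr scale0r addr0.
  + have [ap [a0 [am [h1 h2 h3 h4]]]] := hAt (f i) (hf i).
    by exists ap, a0, am; split => //; rewrite hA// h4.
  + exact: (cvg_drift hrad r0 nur hL0 hLm hLU hD0 hDm hDU hV0 hP hf s1).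
- move=> At s2 hAt k f _ hf.
  apply: (poisson_trace_cvg hrad hinf r0 nur s2 hL0 hLm hLU hD0 hDm hDU hV hV0 hP hf
    (* The trace subtracted is exactly the scalar part of the sum of atoms. *)
    (c_ := fun _ _ => 0) (c := fun=> 0)
    (B := fun n N i => centered_op (A_ n N (f i)))) => [n N i|i|i].
  + have [M ME ->] := hA_ n N (f i) (hf i).
    exists M; split=> // x.
    rewrite /centered_op (atom_trace_sum _ ME) ?mul0r ?sub0r ?scaleNr//.
    exact: (centered_otimes_id_on r0 nur hL0 hD0 hP hf).
  + have [ap [a0 [am [h1 h2 h3 h4]]]] := hAt (f i) (hf i).
    exists ap, a0, am; split => //; rewrite h4; apply/funext => x.
    by rewrite scale0r addr0.
  + exact: cvg_cst.
Qed.
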